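(* For each of the systems V, IX.B(2), IX.B(3), IX.B(5), XII, XIII and XIV listed in the context, a bimeromorphic map $\phi:\mathbf{C}^2\times\mathbf{C}\dashrightarrow\mathbf{C}^2\times\mathbf{C}$ of the form $(\zeta,t)\mapsto(\xi(\zeta,t),t)$, with $\xi$ birational as a function of $\zeta$ for most values of $t$, transforms it into the first-order system in two variables associated to the corresponding Painlevé equation: $(\mathrm{E_I})$ for V, IX.B(2), IX.B(5), XIV; $(\mathrm{E_{II}})$ for IX.B(3), XIII; $(\mathrm{E_{IV}})$ for XII, where $$(\mathrm{E_I})\quad u''=6u^2+f,\quad f''=0;$$ $$(\mathrm{E_{II}})\quad u''=2u^3+fu+\alpha,\quad \alpha\in\mathbf{C},\ f''=0;$$ $$(\mathrm{E_{IV}})\quad u''=\frac{(u')^2}{2u}+\frac32u^3+4fu^2+2(f^2-\alpha)u+\frac{\beta}{u},\quad \alpha,\beta\in\mathbf{C},\ f''=0.$$ **Painlevé I's birational class.** Systems V, IX.B(2), IX.B(5) and XIV are birationally equivalent to the first-order system in two variables associated to $(\mathrm{E_I})$ (and, in particular, are birationally equivalent to one another). More precisely: - (V) System V is exactly the first-order system in two variables associated to $(\mathrm{E_I})$, for the same parameter $f$. - (IX.B(2)) From a solution $(y,z)$ to system IX.B(2) with parameter $q$, $u=\frac16z+q$ is a solution to $(\mathrm{E_I})$ with parameter $f=q''-6q^2$. Reciprocally, for $(\mathrm{E_I})$ with parameter $f$ and a solution $u$ to it, for $q$ defined by $q''=6q^2+f$, $$(y,z)=\left(\frac{u'-q'}{u-q},\,6(u-q)\right)$$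 is a solution to system IX.B(2) with parameter $q$. These two transformations are inverses of one another. - (IX.B(5)) From a solution $(y,z)$ to system IX.B(5) with parameter $q$, $u=y^2-\frac13z-2q$ is a solution to $(\mathrm{E_I})$ with parameter $f=q''-6q^2$. Reciprocally, from a solution $u$ to $(\mathrm{E_I})$ with parameter $f$, for $q$ defined by $f=q''-6q^2$, $$(y,z)=\left(-\frac12\left(\frac{u'-q'}{u-q}\right),\ \frac34\left(\frac{u'-q'}{u-q}\right)^2-3u-6q\right)$$ is a solution to system IX.B(5) with this parameter $q$. These two transformations are inverses of one another. - (XIV) Consider a solution $(y,z)$ to system XIV with parameters $(r,p)$, and let $q=\frac1{12}(p'+p^2-r)$. Then $u=\frac16zy+\frac16r+q$ is a solution to $(\mathrm{E_I})$ with parameter $f=q''-6q^2$. Reciprocally, from a solution $u$ to $(\mathrm{E_I})$ with parameter $f$, for $q$ defined by $q''-6q^2=f$, and $p$ and $r$ satisfying the conditions of system XIV with respect to $q$ (that is, $r'=pr$ and $q=\frac1{12}(p'+p^2-r)$), $$(y,z)=\left(\frac{6u-6q-r}{\frac{u'-q'}{u-q}-p},\ \frac{u'-q'}{u-q}-p\right)$$ is a solution to system XIV with parameters $(r,p)$. These two transformations are inverses of one another. **Painlevé II's birational class.** Systems IX.B(3) and XIII are birationally equivalent to the first-order system in two variables associated to $(\mathrm{E_{II}})$: - (IX.B(3)) From a solution $(y,z)$ to system IX.B(3) with parameters $(f,a_0)$, $y$ is a solution to $(\mathrm{E_{II}})$ for the same $f$ and $\alpha=a_0-\frac12f'$. Reciprocally,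 from a solution $u$ to $(\mathrm{E_{II}})$ with parameters $(f,\alpha)$, $$(y,z)=\left(u,\ u'+u^2+\tfrac12f\right)$$ is a solution to the system IX.B(3) whose parameters are the same $f$ and $a_0=\alpha+\frac12f'$. These two nonlinear polynomial transformations are inverses of one another. - (XIII) For a solution $(y,z)$ of system XIII with parameters $(f,p)$, $u=\frac12y-p$ is a solution to $(\mathrm{E_{II}})$ for the same $f$ and $\alpha=-(p''-2p^3-fp)$. Reciprocally, given $f$ with $f''=0$ and $\alpha\in\mathbf{C}$, from a solution $u$ to the associated equation $(\mathrm{E_{II}})$, for $p$ defined by $\alpha=-(p''-2p^3-fp)$, $$(y,z)=\left(2(u+p),\ u-p+\frac{u'+p'}{u+p}\right)$$ is a solution to system XIII with parameters $(f,p)$. These two transformations are inverses of one another. **Painlevé IV's birational class.** System XII is birationally equivalent to the first-order system in two variables coming from $(\mathrm{E_{IV}})$. If $(y,z)$ is a solution to system XII, $z$ solves $(\mathrm{E_{IV}})$ with the same $f$ and $$\alpha=\tfrac12a_0+b_0-f',\qquad\beta=-\tfrac12a_0^2.$$ Reciprocally, from a solution $u$ to $(\mathrm{E_{IV}})$ with parameters $(f,\alpha,\beta)$, for constants $a_0$ and $b_0$ satisfying these two relations, $$(y,z)=\left(-\frac{u'}{2u}+\frac u2+f-\frac{a_0}{2u},\ u\right)$$ is a solution to system XII with these parameters.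
   Context: The prime denotes the derivative with respect to the independent variable $t$; $f,p,q,r$ are functions of $t$ subject to the indicated conditions and $a_0,b_0$ are constants. The systems are: - V (parameter $f$): $y'=z$, $z'=6y^2+f$, with $f''=0$. - IX.B(2) (parameter $q$): $y'=-y^2+z+12q$, $z'=yz$, with $(q''-6q^2)''=0$. - IX.B(3) (parameters $(f,a_0)$): $y'=-y^2+z-\frac12f$, $z'=2yz+a_0$, with $f''=0$. - IX.B(5) (parameter $q$): $y'=-y^2+z+3q$, $z'=4yz-9q'$, with $(q''-6q^2)''=0$. - XII (parameters $(f,a_0,b_0)$): $y'=y(y-2z)-2fy+b_0$, $z'=z(z-2y)+2fz-a_0$, with $f''=0$. - XIII (parameters $(f,p)$): $y'=\frac12y(2z-y)+2py$, $z'=\frac12z(3y-2z)-4pz+2p^2-2p'+f$, with $f''=0$ and $(p''-2p^3-fp)'=0$. - XIV (parameters $(r,p)$): $y'=y(2z-y)+3py+r$, $z'=z(y-z)-2pz$, with $r'=pr$ and, for $q=\frac1{12}(p'+p^2-r)$, $(q''-6q^2)''=0$. The first-order system in two variables associated to a second-order equation $u''=R(u,u',t)$ is $y'=z$, $z'=R(y,z,t)$ (with $y=u$, $z=u'$). Transformations from a solution $(y,z)$ of one of the quadratic systems to a solution $u$ of a second-order equation are regarded as maps $(y,z)\mapsto(u,u')$, with $u'$ expressed through $(y,z,t)$ by means of the quadratic system. Formulas involving quotients are understood as (bi)rational transformations, i.e. they apply to the solutions for which the denominators do not vanish identically. *)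

(* Defs.v *)
From HB Require Import structures.
From mathcomp Require Import all_boot all_order all_algebra.
From mathcomp Require Import complex.
From mathcomp Require Import all_classical all_reals all_analysis.
Import Order.TTheory GRing.Theory Num.Theory numFieldNormedType.Exports.
Set Implicit Arguments.
Unset Strict Implicit.
Unset Printing Implicit Defensive.
Local Open Scope ring_scope.
Local Open Scope classical_set_scope.

(* The complex numbers over a model R of the reals. Declaring them as an       *)
(* element of numClosedFieldType makes the topology and the normed-module      *)
(* structure of the field over itself available, so that derivable, is_derive  *)
(* and differentiable are the complex notions and derive1 is the complex       *)
(* derivative.                                                                 *)
Definition cplx (R : realType) : numClosedFieldType := R[i]%C.

Section Painleve.
Variable R : realType.
Local Notation C := (cplx R).
Local Notation C2 := (C * C)%type.
Local Notation C3 := (C * C * C)%type.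
Implicit Types (f p q r u : C -> C) (alpha beta t : C)
  (zeta : C -> C2) (D : set C).

(* The right-hand side of a system zeta' = S(zeta, t) in two variables. *)
Definition system := C2 -> C -> C2.

(* The right-hand side of an equation u'' = rhs(u, u', t). *)
Definition equation2 := C -> C -> C -> C.

Definition associated_system (rhs : equation2) : system :=
  fun x t => (x.2, rhs x.1 x.2 t).

Definition domain D := open D /\ connected D.

Definition solves (S : system) D zeta := forall t, D t ->
  is_derive t 1 (fun s => (zeta s).1) (S (zeta t) t).1 /\
  is_derive t 1 (fun s => (zeta s).2) (S (zeta t) t).2.

Definition solves2 (rhs : equation2) D u :=
  solves (associated_system rhs) D (fun t => (u t, derive1 u t)).

(* Conditions on the parameters, at a point t. They include the existence of   *)
(* the derivatives that they mention.                                          *)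

Definition twice_derivable u t := derivable u t 1 /\ derivable (derive1 u) t 1.

Definition second_derivative_zero f t :=
  derivable f t 1 /\ is_derive t 1 (derive1 f : C -> C) 0.

Definition PI_defect q t := derive1 (derive1 q) t - 6 * q t ^+ 2.

Definition PII_defect f p t :=
  derive1 (derive1 p) t - 2 * p t ^+ 3 - f t * p t.

Definition cond_q q t :=
  twice_derivable q t /\ second_derivative_zero (PI_defect q) t.

Definition cond_XIII f p t :=
  [/\ second_derivative_zero f t, twice_derivable p t &
      is_derive t 1 (PII_defect f p) 0].

Definition q_XIV r p t := (derive1 p t + p t ^+ 2 - r t) / 12.

Definition cond_XIV r p t :=
  [/\ is_derive t 1 r (p t * r t), derivable p t 1 & cond_q (q_XIV r p) t].

Definition sys_V f : system := fun x t =>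
  let: (y, z) := x in (z, 6 * y ^+ 2 + f t).

Definition sys_IXB2 q : system := fun x t =>
  let: (y, z) := x in (- y ^+ 2 + z + 12 * q t, y * z).

Definition sys_IXB3 f (a0 : C) : system := fun x t =>
  let: (y, z) := x in (- y ^+ 2 + z - f t / 2, 2 * y * z + a0).

Definition sys_IXB5 q : system := fun x t =>
  let: (y, z) := x in (- y ^+ 2 + z + 3 * q t, 4 * y * z - 9 * derive1 q t).

Definition sys_XII f (a0 b0 : C) : system := fun x t =>
  let: (y, z) := x in
  (y * (y - 2 * z) - 2 * f t * y + b0, z * (z - 2 * y) + 2 * f t * z - a0).

Definition sys_XIII f p : system := fun x t =>
  let: (y, z) := x in
  (y * (2 * z - y) / 2 + 2 * p t * y,
   z * (3 * y - 2 * z) / 2 - 4 * p t * z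
   + 2 * p t ^+ 2 - 2 * derive1 p t + f t).

Definition sys_XIV r p : system := fun x t =>
  let: (y, z) := x in
  (y * (2 * z - y) + 3 * p t * y + r t, z * (y - z) - 2 * p t * z).

Definition PI f : equation2 := fun (u v t : C) => 6 * u ^+ 2 + f t.

Definition PII f alpha : equation2 := fun (u v t : C) =>
  2 * u ^+ 3 + f t * u + alpha.

Definition PIV f alpha beta : equation2 := fun (u v t : C) =>
  v ^+ 2 / (2 * u) + 3 / 2 * u ^+ 3 + 4 * f t * u ^+ 2
  + 2 * (f t ^+ 2 - alpha) * u + beta / u.

(* Being a solution on a set of values of t, conditions on the parameters      *)
(* included.                                                                   *)

Definition sol_V f D zeta :=
  (forall t, D t -> second_derivative_zero f t) /\ solves (sys_V f) D zeta.

Definition sol_IXB2 q D zeta :=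
  (forall t, D t -> cond_q q t) /\ solves (sys_IXB2 q) D zeta.

Definition sol_IXB3 f (a0 : C) D zeta :=
  (forall t, D t -> second_derivative_zero f t) /\
  solves (sys_IXB3 f a0) D zeta.

Definition sol_IXB5 q D zeta :=
  (forall t, D t -> cond_q q t) /\ solves (sys_IXB5 q) D zeta.

Definition sol_XII f (a0 b0 : C) D zeta :=
  (forall t, D t -> second_derivative_zero f t) /\
  solves (sys_XII f a0 b0) D zeta.

Definition sol_XIII f p D zeta :=
  (forall t, D t -> cond_XIII f p t) /\ solves (sys_XIII f p) D zeta.

Definition sol_XIV r p D zeta :=
  (forall t, D t -> cond_XIV r p t) /\ solves (sys_XIV r p) D zeta.

Definition sol_PI f D u :=
  (forall t, D t -> second_derivative_zero f t) /\ solves2 (PI f) D u.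

Definition sol_PII f alpha D u :=
  (forall t, D t -> second_derivative_zero f t) /\ solves2 (PII f alpha) D u.

(* The right-hand side of the fourth equation is only defined for u <> 0. *)
Definition sol_PIV f alpha beta D u :=
  [/\ forall t, D t -> second_derivative_zero f t,
      forall t, D t -> u t != 0 & solves2 (PIV f alpha beta) D u].

(* The maps ((y, z), t) |-> (u, u'). Below, y' and z' stand for the right-hand *)
(* sides of the quadratic system, and u' is the derivative of the expression   *)
(* of u along that system.                                                     *)

Definition to_PI_IXB2 q (x : C3) : C2 :=
  let: (y, z, t) := x in let: (y', z') := sys_IXB2 q (y, z) t in
  (z / 6 + q t, z' / 6 + derive1 q t).

Definition to_PI_IXB5 q (x : C3) : C2 :=
  let: (y, z, t) := x in let: (y', z') := sys_IXB5 q (y, z) t in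
  (y ^+ 2 - z / 3 - 2 * q t, 2 * y * y' - z' / 3 - 2 * derive1 q t).

Definition to_PI_XIV q r p (x : C3) : C2 :=
  let: (y, z, t) := x in let: (y', z') := sys_XIV r p (y, z) t in
  (z * y / 6 + r t / 6 + q t,
   (z' * y + z * y') / 6 + derive1 r t / 6 + derive1 q t).

Definition to_PII_IXB3 f (a0 : C) (x : C3) : C2 :=
  let: (y, z, t) := x in let: (y', z') := sys_IXB3 f a0 (y, z) t in (y, y').

Definition to_PII_XIII f p (x : C3) : C2 :=
  let: (y, z, t) := x in let: (y', z') := sys_XIII f p (y, z) t in
  (y / 2 - p t, y' / 2 - derive1 p t).

Definition to_PIV_XII f (a0 b0 : C) (x : C3) : C2 :=
  let: (y, z, t) := x in let: (y', z') := sys_XII f a0 b0 (y, z) t in (z, z').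

(* The maps ((u, u'), t) |-> (y, z), with v standing for u'. *)

Definition from_PI_IXB2 q (x : C3) : C2 :=
  let: (u, v, t) := x in
  ((v - derive1 q t) / (u - q t), 6 * (u - q t)).

Definition from_PI_IXB5 q (x : C3) : C2 :=
  let: (u, v, t) := x in
  (- (1 / 2) * ((v - derive1 q t) / (u - q t)),
   3 / 4 * ((v - derive1 q t) / (u - q t)) ^+ 2 - 3 * u - 6 * q t).

Definition from_PI_XIV q r p (x : C3) : C2 :=
  let: (u, v, t) := x in
  ((6 * u - 6 * q t - r t) / ((v - derive1 q t) / (u - q t) - p t),
   (v - derive1 q t) / (u - q t) - p t).

Definition from_PII_IXB3 f (x : C3) : C2 :=
  let: (u, v, t) := x in (u, v + u ^+ 2 + f t / 2).

Definition from_PII_XIII p (x : C3) : C2 :=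
  let: (u, v, t) := x in
  (2 * (u + p t), u - p t + (v + derive1 p t) / (u + p t)).

Definition from_PIV_XII f (a0 : C) (x : C3) : C2 :=
  let: (u, v, t) := x in
  (- (v / (2 * u)) + u / 2 + f t - a0 / (2 * u), u).

(* A property holding on the complement of a closed discrete set: every point  *)
(* has a punctured neighbourhood on which it holds.                            *)
Definition generically (P : C -> Prop) :=
  forall t0 : C, \forall t \near t0^', P t.

(* Meromorphic on the whole plane: at every t0, f(t) is given near t0 by a     *)
(* convergent Laurent series with principal part of order at most k. The       *)
(* values of f at its poles are arbitrary.                                     *)
Definition meromorphic f := forall t0 : C, exists (k : nat) (a : nat -> C),
  \forall t \near t0^',
    series (fun n => a n * (t - t0) ^+ n) @ \oo --> ((t - t0) ^+ k * f t : C).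

(* Meromorphic functions of several variables: local quotients of holomorphic  *)
(* functions g / h, where h does not vanish identically on any nonempty open   *)
(* subset of U. The values at the zeros of h are arbitrary.                    *)
Definition meromorphic_nvar (V : normedModType C) (F : V -> C) :=
  forall x : V, exists (U : set V) (g h : V -> C),
    [/\ open U /\ U x,
        forall w, U w -> differentiable g w /\ differentiable h w,
        U `<=` closure [set w | h w != 0] &
        forall w, U w -> h w != 0 -> F w = g w / h w].

Definition over_t (xi : C3 -> C2) : C3 -> C3 := fun x => (xi x, x.2).

Definition biholomorphic_between (W W' : set C3) (xi eta : C3 -> C2) :=
  [/\ forall x, W x -> [/\ differentiable xi x, W' (over_t xi x) &
                           over_t eta (over_t xi x) = x] &
      forall x, W' x -> [/\ differentiable eta x, W (over_t eta x) &
                            over_t xi (over_t eta x) = x]].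

(* The map (zeta, t) |-> (xi (zeta, t), t) is bimeromorphic, with inverse      *)
(* (zeta, t) |-> (eta (zeta, t), t): both are meromorphic on C^3, and they     *)
(* restrict to inverse biholomorphisms between dense open sets.                *)
Definition bimeromorphic_pair (W W' : set C3) (xi eta : C3 -> C2) :=
  [/\ open W /\ dense W, open W' /\ dense W',
      meromorphic_nvar (fun x => (xi x).1) /\
      meromorphic_nvar (fun x => (xi x).2),
      meromorphic_nvar (fun x => (eta x).1) /\
      meromorphic_nvar (fun x => (eta x).2) &
      biholomorphic_between W W' xi eta].

Definition eval2 (P : {poly {poly C}}) (x : C2) : C := (P.[x.2%:P]).[x.1].

(* F is a rational function whose denominator divides Q. *)
Definition rational_off (Q : {poly {poly C}}) (F : C2 -> C) :=
  exists P : {poly {poly C}}, forall x, eval2 Q x != 0 ->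
    F x = eval2 P x / eval2 Q x.

(* F is a birational map of C^2: it is rational and restricts to a bijection,  *)
(* with rational inverse, between the nonempty Zariski open sets Q <> 0 and    *)
(* Q' <> 0.                                                                    *)
Definition birational (F : C2 -> C2) :=
  exists (G : C2 -> C2) (Q Q' : {poly {poly C}}),
    [/\ Q != 0 /\ Q' != 0,
        rational_off Q (fun x => (F x).1) /\ rational_off Q (fun x => (F x).2),
        rational_off Q' (fun x => (G x).1) /\
        rational_off Q' (fun x => (G x).2),
        forall x, eval2 Q x != 0 -> eval2 Q' (F x) != 0 /\ G (F x) = x &
        forall x, eval2 Q' x != 0 -> eval2 Q (G x) != 0 /\ F (G x) = x].

Definition maps_solutions (W : set C3) (xi : C3 -> C2) (S S' : system) :=
  forall D zeta, open D -> (forall t, D t -> W (zeta t, t)) ->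
    solves S D zeta -> solves S' D (fun t => xi (zeta t, t)).

(* A bimeromorphic map of C^2 x C over C, birational on the fibres over all t  *)
(* outside of a closed discrete set, exchanges the two systems.                *)
Definition birationally_equivalent (S S' : system) :=
  exists (xi eta : C3 -> C2) (W W' : set C3),
    [/\ bimeromorphic_pair W W' xi eta,
        generically (fun t => birational (fun x => xi (x, t))),
        maps_solutions W xi S S' &
        maps_solutions W' eta S' S].

(* The quadratic systems attached to the first equation with parameter f. *)
Inductive PI_class f : system -> Prop :=
| PI_class_V : PI_class f (sys_V f)
| PI_class_IXB2 q : meromorphic q -> generically (cond_q q) ->
    generically (fun t => PI_defect q t = f t) -> PI_class f (sys_IXB2 q)
| PI_class_IXB5 q : meromorphic q -> generically (cond_q q) ->
    generically (fun t => PI_defect q t = f t) -> PI_class f (sys_IXB5 q)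
| PI_class_XIV r p : meromorphic r -> meromorphic p ->
    generically (cond_XIV r p) ->
    generically (fun t => PI_defect (q_XIV r p) t = f t) ->
    PI_class f (sys_XIV r p).

End Painleve.

(* Main.v *)
Require Import Defs.
From HB Require Import structures.
From mathcomp Require Import all_boot all_order all_algebra.
From mathcomp Require Import complex ring lra zify.
From mathcomp Require Import all_classical all_reals all_analysis.
Import Order.TTheory GRing.Theory Num.Theory numFieldNormedType.Exports.
Set Implicit Arguments.
Unset Strict Implicit.
Unset Printing Implicit Defensive.
Local Open Scope ring_scope.
Local Open Scope classical_set_scope.

(** The transformations come from one observation. If u and q both solve the
first Painleve equation with the same f, then (u - q)'' = 6 (u + q) (u - q), so
w = (u' - q') / (u - q) satisfies the Riccati equation w' = 6 (u + q) - w^2.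
System IX.B(2) has y = w, system IX.B(5) has y = - w / 2, and system XIV has
z = w - p; the other unknown is then rational in u, w and the parameters. In
the same way, the condition on p in system XIII says that - p solves the second
Painleve equation with the same alpha as u, and w = (u' + p') / (u + p)
satisfies w' = 2 (u^2 - u p + p^2) + f - w^2; there z = u - p + w. For systems
IX.B(3) and XII, u is one unknown, and its equation gives the other one from u'. Checking that solutions go to solutions is a computation at a
single point t (lemmas IXB2_to_PI to PIV_to_XII), and the two directions are
inverse to each other by identities of rational functions (IXB2_fromK to
XII_toK).

For the bimeromorphic equivalences, let T be the interior of the set of t at
which the parameters satisfy their conditions; its complement is closed and
discrete. Over T both maps are rational in two variables, with denominators d
and d' whose coefficients are holomorphic functions of t, and they exchange
d <> 0 and d' <> 0 (strongly_equivalent_intro). These sets are dense because a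
nonzero polynomial vanishes on no open set (eval2_dense). Across the poles of
the parameters the maps stay meromorphic because the derivative of a meromorphic
function is meromorphic (meromorphic_derive1), which rests on differentiating
power series term by term (power_series_derive).

Two systems of the class of the first equation are related through that
equation, so equivalences have to be composed. A meromorphic function may have
its poles along the whole image of a meromorphic map, so meromorphy alone does
not survive composition. The class of functions called stable below is closed
under substitution by definition, contains all the maps above, and gives an
equivalence relation (strongly_equivalent_trans).

Finally, the parameters f and alpha of the Painleve equations are integration
constants: the derivative of a suitable expression vanishes off a closed
discrete set, hence the expression is constant on every punctured disc, and
this constant depends on the centre in a locally constant way
(generically_zero_derive). *)

(** * Pointwise differentiation and the correspondence of solutions *)

Section PointwiseCalculus.
Variable R : realType.
Local Notation K := (cplx R).
Implicit Types (f g : K -> K) (t a b c : K).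

Lemma is_derive_const t c : is_derive t 1 (fun _ => c) (0 : K).
Proof. exact: is_derive_cst. Qed.

Lemma is_derive_add t f g a b : is_derive t 1 f a -> is_derive t 1 g b ->
  is_derive t 1 (fun s => f s + g s) (a + b).
Proof. by move=> ? ?; exact: is_deriveD. Qed.

Lemma is_derive_opp t f a : is_derive t 1 f a ->
  is_derive t 1 (fun s => - f s) (- a).
Proof. by move=> ?; exact: is_deriveN. Qed.

Lemma is_derive_mul t f g a b : is_derive t 1 f a -> is_derive t 1 g b ->
  is_derive t 1 (fun s => f s * g s) (f t * b + g t * a).
Proof. by move=> ? ?; exact: is_deriveM. Qed.

Lemma is_derive_exp t f a n : is_derive t 1 f a ->
  is_derive t 1 (fun s => f s ^+ n) (f t ^+ n.-1 *+ n * a).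
Proof.
move=> df; elim: n => [|n IH].
  by rewrite mulr0n mul0r; under eq_fun do rewrite expr0; exact: is_derive_cst.
under eq_fun do rewrite exprS.
apply: is_derive_eq (is_derive_mul df IH) _.
rewrite /= mulrA -mulrDl; congr (_ * _).
case: n {IH} => [|n]; rewrite ?mulr0n ?mulr0 ?add0r ?mulr1n //.
by rewrite mulrnAr -exprS -mulrSr.
Qed.

Lemma is_derive_inv t f a : f t != 0 -> is_derive t 1 f a ->
  is_derive t 1 (fun s => (f s)^-1) (- a / f t ^+ 2).
Proof.
move=> ft0 [df <-]; apply: DeriveDef; first exact: derivableV.
by rewrite deriveV // /GRing.scale /= mulNr [_^-1 * _]mulrC mulNr.
Qed.

Lemma is_derive_derive1 t f : derivable f t 1 -> is_derive t 1 f (derive1 f t).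
Proof. by move=> df; rewrite derive1E; exact: derivableP. Qed.

Lemma is_derive_derivable t f a : is_derive t 1 f a -> derivable f t 1.
Proof. by case. Qed.

Lemma is_derive_derive1E t f a : is_derive t 1 f a -> derive1 f t = a.
Proof. by move=> df; rewrite derive1E; exact: derive_val. Qed.

Lemma near_is_derive t f g a : (\forall s \near t, f s = g s) ->
  is_derive t 1 f a -> is_derive t 1 g a.
Proof. by move=> fg; exact: near_eq_is_derive fg. Qed.

End PointwiseCalculus.

(* The rules are applied without class resolution, which would otherwise solve
   the goal with derivatives written as scalings, unknown to ring and field. *)
Ltac derive_tac :=
  lazymatch goal with
  | |- is_derive _ 1 (fun _ => ?c) _ => exact: is_derive_const
  | |- is_derive _ 1 (fun s => _ + _) _ =>
    notypeclasses refine (is_derive_add _ _); derive_tac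
  | |- is_derive _ 1 (fun s => - _) _ =>
    notypeclasses refine (is_derive_opp _); derive_tac
  | |- is_derive _ 1 (fun s => _ * _) _ =>
    notypeclasses refine (is_derive_mul _ _); derive_tac
  | |- is_derive _ 1 (fun s => _ ^+ _) _ =>
    notypeclasses refine (is_derive_exp _ _); derive_tac
  | |- is_derive _ 1 (fun s => (_)^-1) _ =>
    notypeclasses refine (is_derive_inv _ _); [try assumption|derive_tac]
  | H : is_derive ?t 1 ?f _ |- is_derive ?t 1 ?f _ => exact: H
  | H : is_derive ?t 1 (fun s => ?f s) _ |- is_derive ?t 1 ?f _ => exact: H
  end.

Ltac derive_by tac :=
  notypeclasses refine (is_derive_eq _ _); [derive_tac .. | tac].

Section Systems.
Variable R : realType.
Local Notation C := (cplx R).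
Local Notation C2 := (C * C)%type.
Local Notation C3 := (C * C * C)%type.

Implicit Types (f p q r u v y z : C -> C) (t alpha beta : C) (zeta : C -> C2).

(** Solving a system is a condition at each point, and so is the correspondence
between solutions: the lemmas below serve both for solutions on a domain and for
solutions whose graph stays in an open set of C^3. *)
Definition solves_at (S : system R) (zeta : C -> C2) (t : C) :=
  is_derive t 1 (fun s => (zeta s).1) (S (zeta t) t).1 /\
  is_derive t 1 (fun s => (zeta s).2) (S (zeta t) t).2.


Lemma pair_fun_ind (P : (C -> C2) -> Prop) :
  (forall y z, P (fun t => (y t, z t))) -> forall zeta, P zeta.
Proof.
move=> Pyz zeta; have -> : zeta = fun t => ((zeta t).1, (zeta t).2).
  by apply/funext => t; case: (zeta t).
exact: Pyz.
Qed.

Lemma PI_defectE (q : C -> C) (t a : C) :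
  PI_defect q t = a -> derive1 (derive1 q) t = a + 6 * q t ^+ 2.
Proof. by move=> <-; rewrite subrK. Qed.

(** Along a solution, u' - q' = y (u - q). *)
Lemma IXB2_to_PI q f zeta t : twice_derivable q t -> PI_defect q t = f t ->
  solves_at (sys_IXB2 q) zeta t ->
  solves_at (associated_system (PI f)) (fun s => to_PI_IXB2 q (zeta s, s)) t.
Proof.
elim/pair_fun_ind: zeta => y z; rewrite /solves_at /=.
move=> [/is_derive_derive1 dq /is_derive_derive1 ddq] /PI_defectE qf [dy dz].
split.
  derive_by ltac:(rewrite /PI /=; field; try trivial).
derive_by ltac:(rewrite /PI /= qf; field; try trivial).
Qed.

Lemma PI_to_IXB2 q f zeta t : twice_derivable q t -> PI_defect q t = f t ->
  (zeta t).1 - q t != 0 ->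
  solves_at (associated_system (PI f)) zeta t ->
  solves_at (sys_IXB2 q) (fun s => from_PI_IXB2 q (zeta s, s)) t.
Proof.
elim/pair_fun_ind: zeta => u v; rewrite /solves_at /=.
move=> [/is_derive_derive1 dq /is_derive_derive1 ddq] /PI_defectE qf uq [du dv].
split.
  derive_by ltac:(rewrite /PI /= qf; field; try trivial).
derive_by ltac:(rewrite /PI /=; field; try trivial).
Qed.

(** Along a solution, u' - q' = - 2 y (u - q). *)
Lemma IXB5_to_PI q f zeta t : twice_derivable q t -> PI_defect q t = f t ->
  solves_at (sys_IXB5 q) zeta t ->
  solves_at (associated_system (PI f)) (fun s => to_PI_IXB5 q (zeta s, s)) t.
Proof.
elim/pair_fun_ind: zeta => y z; rewrite /solves_at /=.
move=> [/is_derive_derive1 dq /is_derive_derive1 ddq] /PI_defectE qf [dy dz].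
split.
  derive_by ltac:(rewrite /PI /=; field; try trivial).
derive_by ltac:(rewrite /PI /= qf; field; try trivial).
Qed.

Lemma PI_to_IXB5 q f zeta t : twice_derivable q t -> PI_defect q t = f t ->
  (zeta t).1 - q t != 0 ->
  solves_at (associated_system (PI f)) zeta t ->
  solves_at (sys_IXB5 q) (fun s => from_PI_IXB5 q (zeta s, s)) t.
Proof.
elim/pair_fun_ind: zeta => u v; rewrite /solves_at /=.
move=> [/is_derive_derive1 dq /is_derive_derive1 ddq] /PI_defectE qf uq [du dv].
split.
  derive_by ltac:(rewrite /PI /= qf; field; try trivial).
derive_by ltac:(rewrite /PI /= qf; field; try trivial).
Qed.

Lemma q_XIVE (q r p : C -> C) t : q t = q_XIV r p t ->
  derive1 p t = 12 * q t - p t ^+ 2 + r t.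
Proof. by move=> ->; rewrite /q_XIV; field. Qed.

(** Along a solution, u' - q' = (z + p) (u - q). The relation r' = p r has to
hold near t because u'' involves r''. *)
Lemma XIV_to_PI q r p f zeta t :
  (\forall s \near t, is_derive (s : C) 1 r (p s * r s)) -> derivable p t 1 ->
  q t = q_XIV r p t -> twice_derivable q t -> PI_defect q t = f t ->
  solves_at (sys_XIV r p) zeta t ->
  solves_at (associated_system (PI f)) (fun s => to_PI_XIV q r p (zeta s, s)) t.
Proof.
elim/pair_fun_ind: zeta => y z; rewrite /solves_at /=.
move=> r_near /is_derive_derive1 dp /q_XIVE p'E.
move=> [/is_derive_derive1 dq /is_derive_derive1 ddq] /PI_defectE qf [dy dz].
have /= dr := @nbhs_singleton _ (t : C) _ r_near.
have r'E : \forall s \near t, p s * r s = derive1 r s.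
  by near=> s; apply/esym/is_derive_derive1E; near: s.
have ddr := near_is_derive r'E (is_derive_mul dp dr).
rewrite -[derive1 r t](@nbhs_singleton _ (t : C) _ r'E).
rewrite p'E in dp ddr.
(* Without a body for r', comparing it with other derivatives is immediate. *)
set r' := derive1 r in r'E ddr *; clearbody r'.
split; first derive_by ltac:(rewrite /PI /=; field; try trivial).
derive_by ltac:(rewrite /PI /= qf; field; try trivial).
Unshelve. all: by end_near. Qed.

Lemma PI_to_XIV q r p f zeta t :
  is_derive t 1 r (p t * r t) -> derivable p t 1 ->
  q t = q_XIV r p t -> twice_derivable q t -> PI_defect q t = f t ->
  (zeta t).1 - q t != 0 ->
  ((zeta t).2 - derive1 q t) / ((zeta t).1 - q t) - p t != 0 ->
  solves_at (associated_system (PI f)) zeta t ->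
  solves_at (sys_XIV r p) (fun s => from_PI_XIV q r p (zeta s, s)) t.
Proof.
elim/pair_fun_ind: zeta => u v; rewrite /solves_at /=.
move=> dr /is_derive_derive1 dp /q_XIVE p'E.
move=> [/is_derive_derive1 dq /is_derive_derive1 ddq] /PI_defectE qf uq wp [du dv].
rewrite p'E in dp.
have vq : v t - derive1 q t - p t * (u t - q t) != 0.
  apply: contra_neq wp => vq; apply: (mulIf uq).
  by rewrite mul0r mulrBl divfK // vq.
split; first derive_by ltac:(rewrite /PI /= qf; field; by rewrite uq ?mulNr vq).
derive_by ltac:(rewrite /PI /= qf; field; by rewrite uq ?mulNr vq).
Qed.

Lemma IXB3_to_PII f a0 alpha zeta t : derivable f t 1 ->
  alpha = a0 - derive1 f t / 2 ->
  solves_at (sys_IXB3 f a0) zeta t ->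
  solves_at (associated_system (PII f alpha))
    (fun s => to_PII_IXB3 f a0 (zeta s, s)) t.
Proof.
elim/pair_fun_ind: zeta => y z; rewrite /solves_at /=.
move=> /is_derive_derive1 df -> [dy dz]; split; first exact: dy.
derive_by ltac:(rewrite /PII /=; field; try trivial).
Qed.

Lemma PII_to_IXB3 f a0 alpha zeta t : derivable f t 1 ->
  alpha = a0 - derive1 f t / 2 ->
  solves_at (associated_system (PII f alpha)) zeta t ->
  solves_at (sys_IXB3 f a0) (fun s => from_PII_IXB3 f (zeta s, s)) t.
Proof.
elim/pair_fun_ind: zeta => u v; rewrite /solves_at /=.
move=> /is_derive_derive1 df -> [du dv]; split.
  derive_by ltac:(rewrite /PII /=; field; try trivial).
derive_by ltac:(rewrite /PII /=; field; try trivial).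
Qed.

Lemma PII_defectE (f p : C -> C) (t alpha : C) : alpha = - PII_defect f p t ->
  derive1 (derive1 p) t = 2 * p t ^+ 3 + f t * p t - alpha.
Proof. by move=> ->; rewrite /PII_defect; ring. Qed.

(** Along a solution, u' + p' = (z - u + p) (u + p), where u + p = y / 2. *)
Lemma XIII_to_PII f p alpha zeta t : twice_derivable p t ->
  alpha = - PII_defect f p t ->
  solves_at (sys_XIII f p) zeta t ->
  solves_at (associated_system (PII f alpha))
    (fun s => to_PII_XIII f p (zeta s, s)) t.
Proof.
elim/pair_fun_ind: zeta => y z; rewrite /solves_at /=.
move=> [/is_derive_derive1 dp /is_derive_derive1 ddp] /PII_defectE pf [dy dz].
split.
  derive_by ltac:(rewrite /PII /=; field; try trivial).
derive_by ltac:(rewrite /PII /= pf; field; try trivial).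
Qed.

Lemma PII_to_XIII f p alpha zeta t : twice_derivable p t ->
  alpha = - PII_defect f p t -> (zeta t).1 + p t != 0 ->
  solves_at (associated_system (PII f alpha)) zeta t ->
  solves_at (sys_XIII f p) (fun s => from_PII_XIII p (zeta s, s)) t.
Proof.
elim/pair_fun_ind: zeta => u v; rewrite /solves_at /=.
move=> [/is_derive_derive1 dp /is_derive_derive1 ddp] /PII_defectE pf up [du dv].
split.
  derive_by ltac:(rewrite /PII /=; field; try trivial).
derive_by ltac:(rewrite /PII /= pf; field; try trivial).
Qed.

(** With u = z, the second equation u' = u (u - 2 y + 2 f) - a0 is affine in y,
so that y is a rational function of u and u'. *)
Lemma XII_to_PIV f a0 b0 alpha beta zeta t : derivable f t 1 ->
  alpha = a0 / 2 + b0 - derive1 f t -> beta = - (a0 ^+ 2 / 2) ->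
  (zeta t).2 != 0 ->
  solves_at (sys_XII f a0 b0) zeta t ->
  solves_at (associated_system (PIV f alpha beta))
    (fun s => to_PIV_XII f a0 b0 (zeta s, s)) t.
Proof.
elim/pair_fun_ind: zeta => y z; rewrite /solves_at /=.
move=> /is_derive_derive1 df -> -> z0 [dy dz]; split; first exact: dz.
derive_by ltac:(rewrite /PIV /=; field; try trivial).
Qed.

Lemma PIV_to_XII f a0 b0 alpha beta zeta t : derivable f t 1 ->
  alpha = a0 / 2 + b0 - derive1 f t -> beta = - (a0 ^+ 2 / 2) ->
  (zeta t).1 != 0 ->
  solves_at (associated_system (PIV f alpha beta)) zeta t ->
  solves_at (sys_XII f a0 b0) (fun s => from_PIV_XII f a0 (zeta s, s)) t.
Proof.
elim/pair_fun_ind: zeta => u v; rewrite /solves_at /=.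
move=> /is_derive_derive1 df -> -> u0 [du dv].
have uu0 : 2 * u t != 0 by rewrite mulf_neq0 ?pnatr_eq0.
split.
  derive_by ltac:(rewrite /PIV /=; field; try trivial).
derive_by ltac:(rewrite /PIV /=; field; try trivial).
Qed.

End Systems.

(** * The transformations are inverse to each other *)

Ltac nonzero_by H :=
  lazymatch goal with
  | |- is_true true => exact: isT
  | |- is_true (?x != 0) =>
    lazymatch type of H with is_true (?a != 0) =>
      tryif constr_eq x a then idtac else have -> : x = a by ring end;
    exact: H
  end.

Section Inverses.
Variable R : realType.
Local Notation C := (cplx R).
Local Notation C2 := (C * C)%type.
Local Notation C3 := (C * C * C)%type.
Implicit Types (f p q r : C -> C) (t u v y z : C).

Lemma IXB2_fromK q t y z : z != 0 ->
  from_PI_IXB2 q (to_PI_IXB2 q (y, z, t), t) = (y, z).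
Proof. by move=> z0; congr (_, _) => /=; field; nonzero_by z0. Qed.

Lemma IXB2_toK q t u v : u != q t ->
  to_PI_IXB2 q (from_PI_IXB2 q (u, v, t), t) = (u, v).
Proof.
by rewrite -subr_eq0 => uq; congr (_, _) => /=; field.
Qed.

Lemma IXB5_fromK q t y z : y ^+ 2 - z / 3 - 2 * q t != q t ->
  from_PI_IXB5 q (to_PI_IXB5 q (y, z, t), t) = (y, z).
Proof.
rewrite -subr_eq0 => yz.
have yz' : 3 * y ^+ 2 - z - 9 * q t != 0.
  by apply: contra_neq yz => yz; rewrite -(mulr0 3^-1) -yz; field.
congr (_, _) => /=; field; nonzero_by yz'.
Qed.

Lemma IXB5_toK q t u v : u != q t ->
  to_PI_IXB5 q (from_PI_IXB5 q (u, v, t), t) = (u, v).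
Proof.
by rewrite -subr_eq0 => uq; congr (_, _) => /=; field.
Qed.

Lemma XIV_fromK q r p t y z : derive1 r t = p t * r t ->
  z * y / 6 + r t / 6 + q t != q t -> z != 0 ->
  from_PI_XIV q r p (to_PI_XIV q r p (y, z, t), t) = (y, z).
Proof.
rewrite -subr_eq0 addrK -mulrDl /from_PI_XIV /to_PI_XIV /= => -> zyr z0.
have {}zyr : z * y + r t != 0 by apply: contra_neq zyr => ->; rewrite mul0r.
have wE : ((z * (y - z) - 2 * p t * z) * y
   + z * (y * (2 * z - y) + 3 * p t * y + r t)) / 6 + p t * r t / 6
   + derive1 q t - derive1 q t = (z + p t) * (z * y / 6 + r t / 6 + q t - q t).
  by field.
rewrite wE mulfK; last first.
  rewrite addrK -mulrDl mulf_neq0 // invr_eq0 pnatr_eq0 //.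
by rewrite addrK; congr (_, _) => /=; field.
Qed.

Lemma XIV_toK q r p t u v : derive1 r t = p t * r t -> u != q t ->
  (v - derive1 q t) / (u - q t) != p t ->
  to_PI_XIV q r p (from_PI_XIV q r p (u, v, t), t) = (u, v).
Proof.
move=> dr; rewrite -subr_eq0 => uq; rewrite -subr_eq0.
rewrite /from_PI_XIV /to_PI_XIV /= dr.
have : v = (v - derive1 q t) / (u - q t) * (u - q t) + derive1 q t.
  by rewrite divfK // subrK.
set w := _ / _ => vE wp; congr (_, _); first by field.
by rewrite [RHS]vE; field.
Qed.

Lemma IXB3_fromK f a0 t y z :
  from_PII_IXB3 f (to_PII_IXB3 f a0 (y, z, t), t) = (y, z).
Proof. by congr (_, _) => /=; field. Qed.

Lemma IXB3_toK f a0 t u v :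
  to_PII_IXB3 f a0 (from_PII_IXB3 f (u, v, t), t) = (u, v).
Proof. by congr (_, _) => /=; field. Qed.

Lemma XIII_fromK f p t y z : y != 0 ->
  from_PII_XIII p (to_PII_XIII f p (y, z, t), t) = (y, z).
Proof. by move=> y0; congr (_, _) => /=; field; nonzero_by y0. Qed.

Lemma XIII_toK f p t u v : u + p t != 0 ->
  to_PII_XIII f p (from_PII_XIII p (u, v, t), t) = (u, v).
Proof. by move=> up; congr (_, _) => /=; field. Qed.

Lemma XII_fromK f a0 b0 t y z : z != 0 ->
  from_PIV_XII f a0 (to_PIV_XII f a0 b0 (y, z, t), t) = (y, z).
Proof. by move=> z0; congr (_, _) => /=; field; nonzero_by z0. Qed.

Lemma XII_toK f a0 b0 t u v : u != 0 ->
  to_PIV_XII f a0 b0 (from_PIV_XII f a0 (u, v, t), t) = (u, v).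
Proof. by move=> u0; congr (_, _) => /=; field. Qed.

End Inverses.

(** * Functions with vanishing derivative *)

Section Growth.
Variable K : numFieldType.

(** The derivative as an estimate: in this form it passes to the real coordinates
of a complex function and to the limit of partial sums. *)
Lemma is_derive_growthP (f : K -> K) (t l : K) :
  is_derive t 1 f l <-> forall e, 0 < e ->
    \forall h \near (0 : K), `|f (t + h) - f t - l * h| <= e * `|h|.
Proof.
have quotE (h : K) : h != 0 ->
    h^-1 * (f (h * 1 + t) - f t) - l = h^-1 * (f (t + h) - f t - l * h).
  move=> h0; rewrite mulr1 [h + t]addrC [in RHS]mulrBr.
  by rewrite [in RHS](mulrC _ (l * h)) mulfK.
split=> [[df lE] e e0|H].
  have /cvgrPdistC_le/(_ e e0) : h^-1 *: (f (h *: 1 + t) - f t) @[h --> 0^'] -->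
    l by rewrite -lE; exact: df.
  rewrite near_withinE; apply: filterS => h hP.
  have [->|h0] := eqVneq h 0; first by rewrite mulr0 addr0 !subrr !normr0 mulr0.
  have : `|h^-1 * (f (h * 1 + t) - f t) - l| <= e := hP h0.
  by rewrite quotE // normrM normfV ler_pdivrMl ?normr_gt0 // [e * _]mulrC.
have df : h^-1 *: (f (h *: 1 + t) - f t) @[h --> 0^'] --> l.
  apply/cvgrPdistC_le => e e0; rewrite near_withinE.
  apply: filterS (H e e0) => h hP h0.
  rewrite -[X in `|X|]/(h^-1 * (f (h * 1 + t) - f t) - l) quotE // normrM normfV.
  by rewrite ler_pdivrMl ?normr_gt0 // [`|h| * _]mulrC.
by apply: DeriveDef; [apply/cvg_ex; exists l | exact/cvg_lim].
Qed.
End Growth.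


Section ZeroDerivative.
Variable R : realType.
Local Notation C := (cplx R).
Implicit Types (g : C -> C) (a b t : C) (D : set C).

Lemma normc_ge_Im (z : R[i]) : (`|complex.Im z|)%:C%C <= `|z|.
Proof.
rewrite -[complex.Im z]opprK -ReiNIm normrN.
apply: le_trans (normc_ge_Re _) _.
by rewrite normrM [X in _ * X]normc_def /= expr0n expr1n /= add0r sqrtr1 mulr1.
Qed.

Lemma real_complex_near0 (P : C -> Prop) :
  (\forall h \near (0 : C), P h) -> \forall k \near (0 : R), P k%:C%C.
Proof.
move=> /nbhs_ballP[e e0 eP].
apply/nbhs_ballP; exists (complex.Re (e : R[i])).
  by move: e0; rewrite /= ltcE => /andP[].
move=> k; rewrite -!ball_normE /= sub0r normrN => ke.
apply: eP; rewrite -ball_normE /= sub0r normrN.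
move: e0; rewrite /= ltcE => /andP[/= /eqP e0 _].
rewrite ltcE normc_def /= e0 eqxx /= expr0n /= addr0 sqrtr_sqr.
exact: ke.
Qed.

(** The mean value theorem is false for complex functions, but it applies to the
two real coordinates of g along the segment. *)
Lemma zero_derive_segment g a b :
  (forall s : R, 0 <= s <= 1 -> is_derive (a + s%:C%C * (b - a)) 1 g 0) ->
  g a = g b.
Proof.
move=> dg.
suff coord (L : R[i] -> R) : {morph L : x y / x - y} ->
    (forall z : C, (`|L z|)%:C%C <= `|z|) -> L (g a) = L (g b).
  have eqRe := coord (@complex.Re R) _ _; have eqIm := coord (@complex.Im R) _ _.
  apply/eqP; rewrite eq_complex; apply/andP; split; apply/eqP.
    apply: eqRe => [[x x'] [y y']//|z]; exact: normc_ge_Re.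
  apply: eqIm => [[x x'] [y y']//|z]; exact: normc_ge_Im.
move=> LB Lle; pose h (s : R) := L (g (a + s%:C%C * (b - a))).
have dh (s : R) : 0 <= s <= 1 -> is_derive s 1 h 0.
  move=> /dg /is_derive_growthP dgs; apply/is_derive_growthP => e e0.
  pose M : C := `|b - a| + 1.
  have M0 : 0 < M by rewrite ltr_wpDl.
  have eM0 : 0 < e%:C%C / M by rewrite divr_gt0 // ltcR.
  have dir0 : (b - a) * x @[x --> nbhs (0 : C)] --> (0 : C).
    by rewrite -[X in _ --> X](mulr0 (b - a)); apply: cvgMl_tmp; exact: cvg_id.
  have /real_complex_near0 := dir0 _ (dgs _ eM0).
  apply: filterS => k; rewrite /= !mul0r !subr0 => gk.
  rewrite /h -LB -lecR (le_trans (Lle _)) //.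
  have -> : a + (s + k)%:C%C * (b - a) =
      a + s%:C%C * (b - a) + (b - a) * k%:C%C.
    by rewrite (_ : (s + k)%:C%C = s%:C%C + k%:C%C) ?rmorphD //; ring.
  apply: le_trans gk _.
  have -> : (e * `|k|)%:C%C = e%:C%C / M * (M * `|k%:C%C|).
    rewrite mulrA divfK ?gt_eqF // rmorphM; congr (_ * _).
    by rewrite normc_def /= expr0n /= addr0 sqrtr_sqr.
  rewrite normrM ler_pM2l // ler_wpM2r // ler_wpDr //.
have [||c _] := @MVT_segment R h (cst 0) 0 1 ler01.
- by move=> x; rewrite in_itv /= => /andP[x0 x1]; apply: dh; rewrite !ltW.
- apply: derivable_within_continuous => x; rewrite in_itv /= => /dh dx.
  exact: ex_derive.
have -> : h 1 = L (g b) by rewrite /h rmorph1 mul1r addrC subrK.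
have -> : h 0 = L (g a) by rewrite /h rmorph0 mul0r addr0.
by rewrite mul0r => /eqP; rewrite subr_eq0 => /eqP.
Qed.




Lemma segment_lt_radius (x y e : C) (s : R) : 0 <= s <= 1 ->
  `|x| < e -> `|y| < e -> `|x + s%:C%C * (y - x)| < e.
Proof.
move=> /andP[s0 s1] xe ye.
have -> : x + s%:C%C * (y - x) = (1 - s%:C%C) * x + s%:C%C * y by ring.
have sC0 : 0 <= s%:C%C :> C by rewrite ler0c.
have sC1 : 0 <= 1 - s%:C%C :> C by rewrite subr_ge0 lecR.
apply: le_lt_trans (ler_normD _ _) _; rewrite !normrM (ger0_norm sC0) (ger0_norm sC1).
have [->|s_neq1] := eqVneq s 1; first by rewrite rmorph1 subrr mul0r add0r mul1r.
have sC1' : 0 < 1 - s%:C%C :> C by rewrite subr_gt0 ltcR lt_neqAle s_neq1.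
rewrite [ltRHS](_ : e = (1 - s%:C%C) * e + s%:C%C * e); last by ring.
apply: ltr_leD; first by rewrite ltr_pM2l.
by apply: ler_wpM2l => //; exact: ltW.
Qed.

(** A punctured disc is not convex, but any two of its points are joined by one or
two segments that avoid the centre. *)
Lemma zero_derive_punctured g t0 :
  (\forall t \near t0^', is_derive (t : C) 1 g 0) ->
  exists c, \forall t \near t0^', g t = c.
Proof.
rewrite near_withinE => /nbhs_ballP[e /= e0 eP].
have dg (x : C) : `|x| < e -> x != 0 -> is_derive (t0 + x) 1 g 0.
  move=> xe x0; apply: eP; last by rewrite -subr_eq0 addrAC subrr add0r.
  by rewrite -ball_normE /= opprD addNKr normrN.
have seg x y : `|x| < e -> `|y| < e ->
    (forall s : R, 0 <= s <= 1 -> x + s%:C%C * (y - x) != 0) ->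
    g (t0 + x) = g (t0 + y).
  move=> xe ye xy0; apply: zero_derive_segment => s s01.
  have -> : t0 + x + s%:C%C * (t0 + y - (t0 + x)) =
    t0 + (x + s%:C%C * (y - x)) by ring.
  by apply: dg; [exact: segment_lt_radius|exact: xy0].
have all_eq x y : `|x| < e -> `|y| < e -> x != 0 -> y != 0 ->
    g (t0 + x) = g (t0 + y).
  move=> xe ye x0 y0.
  have [xy0|] := pselect (forall s : R, 0 <= s <= 1 -> x + s%:C%C * (y - x) != 0).
    exact: seg.
  (* The segment from x to y meets 0, so y is a negative multiple of x, and the
     segments from x to i x and from i x to y avoid 0. *)
  move=> /existsNP[s /not_implyP[/andP[s0 s1] /negP/negPn/eqP xy0]].
  have s_gt0 : 0 < s.
    rewrite lt_neqAle s0 andbT; apply/eqP => s_0; move: xy0.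
    by rewrite -s_0 rmorph0 mul0r addr0; apply/eqP.
  pose k := (1 - s) / s.
  have yE : y = - k%:C%C * x.
    have sC0 : s%:C%C != 0 :> C by rewrite gt_eqF // ltcR.
    apply: (mulfI sC0); rewrite /k rmorphM fmorphV rmorphB rmorph1 /=.
    have -> : s%:C%C * y = - (1 - s%:C%C) * x.
      by apply/eqP; rewrite -subr_eq0; apply/eqP; rewrite -[RHS]xy0; ring.
    by field.
  have s_lt1 : s < 1.
    rewrite lt_neqAle s1 andbT; apply: contra_neq y0 => s_1.
    by rewrite yE /k s_1 subrr mul0r rmorph0 oppr0 mul0r.
  have k0 : 0 < k by rewrite divr_gt0 // subr_gt0.
  have ixe : `|'i%C * x| < e.
    by rewrite normrM [X in X * _]normc_def /= expr0n expr1n /= add0r sqrtr1 mul1r.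
  rewrite (seg x ('i%C * x)) //; last first.
    move=> r _; have -> : x + r%:C%C * ('i%C * x - x) =
      (1 - r%:C%C + r%:C%C * 'i%C) * x by ring.
    rewrite mulf_neq0 // eq_complex /=; apply/negP => /andP[/eqP h1 /eqP h2].
    by clear -h1 h2; lra.
  apply: seg => // r _.
  have -> : 'i%C * x + r%:C%C * (y - 'i%C * x) =
    ((1 - r%:C%C) * 'i%C - r%:C%C * k%:C%C) * x by rewrite yE; ring.
  rewrite mulf_neq0 // eq_complex /=; apply/negP => /andP[/eqP h1 /eqP h2].
  clear -k0 h1 h2; clearbody k; have r1 : r = 1 by lra.
  by rewrite r1 in h1; lra.
exists (g (t0 + e / 2)); rewrite near_withinE; apply/nbhs_ballP; exists e => //.
move=> t; rewrite -ball_normE /= -normrN opprB => te tt0.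
rewrite -[t in LHS](subrKC t0); apply: all_eq => //.
- rewrite ger0_norm ?ltr_pdivrMr // ?mulr_ge0 ?invr_ge0 // ?(ltW e0) //.
  by rewrite ltr_pMr // ltr1n.
- by rewrite subr_eq0.
- by rewrite mulf_neq0 // ?invr_eq0 ?pnatr_eq0 // gt_eqF.
Qed.

End ZeroDerivative.

Section Generic.
Variable R : realType.
Local Notation C := (cplx R).
Implicit Types (f g : C -> C) (a b t : C) (D T : set C) (P Q : C -> Prop).

Lemma near_neq (t t0 : C) : t != t0 -> \forall s \near t, s != t0.
Proof.
move=> tt0; have cvg_sub : s - t0 @[s --> t] --> t - t0.
  apply: (@cvgB C C C (nbhs t) _ id (cst t0)); first exact: cvg_id.
  exact: (@cvg_cst C).
have t_neq : t - t0 != 0 by rewrite subr_eq0.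
by near=> s; rewrite -subr_eq0; near: s; exact: cvgr_neq0 cvg_sub t_neq.
Unshelve. all: by end_near. Qed.

Lemma dnbhs_neq (t t0 : C) : \forall s \near t^', s != t0.
Proof.
rewrite near_withinE; have [<-|tt0] := eqVneq t t0; first exact: nearW.
by apply: filterS (near_neq tt0) => s.
Qed.

Lemma dnbhs_interior (t0 : C) P : (\forall t \near t0^', P t) ->
  \forall t \near t0^', \forall s \near t, P s.
Proof.
rewrite !near_withinE => /nbhs_interior; apply: filterS => t tP tt0.
have tt0' := near_neq tt0.
by near=> s; apply: (near tP s) => //; near: s.
Unshelve. all: by end_near. Qed.

Lemma generically_interior P :
  generically P -> generically (fun t => \forall s \near t, P s).
Proof. by move=> gP t0; exact: dnbhs_interior. Qed.

Lemma generically_and P Q : generically P -> generically Q ->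
  generically (fun t => P t /\ Q t).
Proof. by move=> gP gQ t0; apply: filterS2 (gP t0) (gQ t0). Qed.

Lemma sub_generically P Q : (forall t, P t -> Q t) ->
  generically P -> generically Q.
Proof. by move=> PQ gP t0; apply: filterS (gP t0). Qed.

Lemma generically_everywhere P : (forall t, P t) -> generically P.
Proof. by move=> allP t0; exact: nearW. Qed.

Lemma generically_dense P : generically P -> dense [set t | P t].
Proof.
move=> gP O [t0 Ot0] Oopen.
have : \forall t \near t0^', O t /\ P t.
  near=> t; split; near: t; last exact: gP.
  by apply: nbhs_dnbhs; exact: open_nbhs_nbhs.
by move=> /filter_ex[t [Ot Pt]]; exists t.
Unshelve. all: by end_near. Qed.

Lemma local_constant_derive g t : (\forall s \near t, g s = g t) ->
  is_derive t 1 g 0.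
Proof.
move=> gt; apply: near_is_derive (is_derive_const t (g t)).
by apply: filterS gt => s ->.
Qed.

(** By zero_derive_punctured, g has a constant germ c t0 around every t0. Nearby
punctured discs overlap, so c is locally constant, hence constant. *)
Lemma generically_zero_derive g :
  generically (fun t => is_derive t 1 g 0) ->
  exists c, generically (fun t => g t = c).
Proof.
move=> dg; have germ t0 : exists c, \forall t \near t0^', g t = c.
  by apply: zero_derive_punctured; exact: dg.
have [c cP] := choice germ.
have c_derive t : is_derive t 1 c 0.
  apply: local_constant_derive.
  have := dnbhs_interior (cP t); rewrite near_withinE; apply: filterS => s.
  have [-> //|st /(_ isT) gct]:= eqVneq s t.
  have : \forall r \near s^', c s = c t.
    by apply: filterS2 (cP s) (nbhs_dnbhs gct) => r <- <-.
  by move=> /filter_ex[].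
exists (c 0) => t; rewrite (@zero_derive_segment _ c 0 t) //; exact: cP.
Qed.

Lemma derive1_affine (a b : C) : derive1 (fun t : C => a + b * t) = cst b.
Proof.
apply/funext => t.
have dt : is_derive t 1 (id : C -> C) (1 : C) by exact: is_derive_id.
have /is_derive_derive1E -> := is_derive_add (is_derive_const t a)
  (is_derive_mul (is_derive_const t b) dt).
by rewrite mulr1 mulr0 addr0 add0r.
Qed.

Lemma generically_affine g :
  generically (second_derivative_zero g) ->
  exists f, (forall t, second_derivative_zero f t) /\
            generically (fun t => g t = f t).
Proof.
move=> g2.
have [b g'b] : exists b, generically (fun t => derive1 g t = b).
  by apply: generically_zero_derive; apply: sub_generically g2 => t [].
have dt (t : C) : is_derive t 1 (id : C -> C) (1 : C) by exact: is_derive_id.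
have [a gab] : exists a, generically (fun t => g t - b * t = a).
  apply: generically_zero_derive.
  apply: sub_generically (generically_and g2 g'b) => t [[dg _] g't].
  have := is_derive_add (is_derive_derive1 dg)
    (is_derive_opp (is_derive_mul (is_derive_const t b) (dt t))).
  by rewrite g't mulr1 mulr0 addr0 subrr.
exists (fun t => a + b * t); split=> [t|].
  have := is_derive_add (is_derive_const t a)
    (is_derive_mul (is_derive_const t b) (dt t)) => /is_derive_derivable dab.
  by split; [exact: dab|rewrite derive1_affine; exact: is_derive_const].
by apply: sub_generically gab => t <-; rewrite subrK.
Qed.

(** The level sets of g in D are open, being unions of discs, and so are their
complements. *)
Lemma domain_zero_derive D g : domain D ->
  (forall t, D t -> is_derive t 1 g 0) -> exists c, forall t, D t -> g t = c.
Proof.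
move=> [Dopen Dconn] dg.
have [[t0 Dt0]|D0] := pselect (D !=set0); last first.
  by exists 0 => t Dt; case: D0; exists t.
have near_const t : D t -> \forall s \near t, g s = g t.
  move=> Dt; have /nbhs_ballP[e /= e0 eD] := open_nbhs_nbhs (conj Dopen Dt).
  apply/nbhs_ballP; exists e => // s ts; have {}ts : `|t - s| < e := ts.
  apply/esym; refine (zero_derive_segment (fun r r01 => dg _ (eD _ _))).
  suff : `|t - (t + r%:C%C * (s - t))| < e by [].
  rewrite opprD addNKr normrN.
  have := @segment_lt_radius _ 0 (s - t) e r r01.
  rewrite add0r subr0; apply; first by rewrite normr0.
  by rewrite distrC.
exists (g t0) => t Dt.
have open_level (P : C -> Prop) : open (D `&` [set s | P (g s)]).
  rewrite openE => s [Ds Ps]; apply: filterS2 (near_const s Ds)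
    (open_nbhs_nbhs (conj Dopen Ds)) => r /= gr Dr.
  by split => //=; rewrite gr.
suff DE : D `&` [set s | g s = g t0] = D by move: Dt; rewrite -DE => -[].
apply: Dconn; first by exists t0.
  exists (D `&` [set s | g s = g t0]); last by rewrite setIA setIid.
  exact: (open_level (fun z => z = g t0)).
exists (~` (D `&` [set s | g s <> g t0])).
  exact/open_closedC/(open_level (fun z => z <> g t0)).
apply/seteqP; split=> s [Ds /= gs]; split => //; first by case.
by apply: contrapT => gst; apply: gs.
Qed.

End Generic.

(** * Power series *)

Section PowerSeries.
Variable R : realType.
Local Notation C := (cplx R).
Implicit Types (a u : nat -> C) (z h : C).

Lemma cvg_real_complex (x : nat -> R) (l : R) :
  x @ \oo --> l -> (fun n => (x n)%:C%C : C) @ \oo --> (l%:C%C : C).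
Proof.
move=> /cvgrPdist_le xl; apply/cvgrPdist_le => e e0.
have eE : (complex.Re e)%:C%C = e by apply: RRe_real; exact: gtr0_real.
have e0' : 0 < complex.Re e by rewrite -ltcR eE.
have := xl _ e0'; apply: filterS => n /= lxn.
by rewrite -rmorphB normc_def /= expr0n /= addr0 sqrtr_sqr -eE lecR.
Qed.

(** The real and imaginary parts converge absolutely, and the real numbers are
complete; the factor 2 ^+ n is what power_series_derive has at its disposal. *)
Lemma cvg_series_half u (K : R) :
  (forall n, `|u n| <= (K / 2 ^+ n)%:C%C) -> exists l : C, series u @ \oo --> l.
Proof.
move=> uK.
have K0 : 0 <= K.
  by have := le_trans (normr_ge0 _) (uK 0%N); rewrite expr0 divr1 ler0c.
have coord (L : R[i] -> R) : (forall z : C, (`|L z|)%:C%C <= `|z|) ->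
    exists l : R, series (L \o u) @ \oo --> l.
  move=> Lle; apply/cvg_ex; apply: normed_cvg.
  apply: (@series_le_cvg _ _ (geometric K 2^-1)) => [n|n|n|].
  - exact: normr_ge0.
  - by rewrite /geometric /= mulr_ge0 // exprn_ge0.
  - rewrite /geometric /= exprVn -lecR; exact: le_trans (Lle _) (uK n).
  - apply: is_cvg_geometric_series.
    by rewrite ger0_norm // invf_lt1 // ltr1n.
have [x xP] := coord (@complex.Re R) (@normc_ge_Re R).
have [y yP] := coord (@complex.Im R) (@normc_ge_Im R).
exists (x%:C%C + 'i%C * y%:C%C).
have -> : series u = fun n => (series (@complex.Re R \o u) n)%:C%C +
    'i%C * (series (@complex.Im R \o u) n)%:C%C.
  apply/funext => n; rewrite /series /= !raddf_sum /= mulr_sumr -big_split /=.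
  by apply: eq_bigr => k _; rewrite -complexE.
apply: (@cvgD C C nat \oo _ (fun n => (series (@complex.Re R \o u) n)%:C%C)
  (fun n => 'i%C * (series (@complex.Im R \o u) n)%:C%C)).
  exact: cvg_real_complex.
by apply: cvgMl_tmp; exact: cvg_real_complex.
Qed.

(** By induction from E (n + 1) = (z + h) E n + n z^(n - 1) h^2 for the remainders
E n. The factor r ^+ 2 stands on the left to avoid the exponent n - 2, which
truncated subtraction would make wrong for small n. *)
Lemma taylor2_bound (K : numFieldType) (z h r : K) n :
  `|z| <= r -> `|z + h| <= r ->
  r ^+ 2 * `|(z + h) ^+ n - z ^+ n - n%:R * z ^+ n.-1 * h|
    <= n%:R ^+ 2 * r ^+ n * `|h| ^+ 2.
Proof.
move=> zr zhr; have r0 : 0 <= r := le_trans (normr_ge0 _) zr.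
elim: n => [|n IH].
  by rewrite !expr0 subrr mul0r mul0r subr0 normr0 mulr0 expr0n /= !mul0r.
set E := (z + h) ^+ n - _ - _ in IH.
have -> : (z + h) ^+ n.+1 - z ^+ n.+1 - n.+1%:R * z ^+ n.+1.-1 * h =
    (z + h) * E + n%:R * z ^+ n.-1 * h ^+ 2.
  rewrite /E; case: n {IH E} => [|n]; first by rewrite /=; ring.
  by rewrite /= !exprS -[n.+2]addn1 natrD; ring.
have rn : r ^+ 2 * `|n%:R * z ^+ n.-1 * h ^+ 2| <= n%:R * r ^+ n.+1 * `|h| ^+ 2.
  case: n {IH E} => [|n]; first by rewrite !mul0r normr0 mulr0.
  rewrite !normrM !normrX normr_nat /= [X in X <= _]mulrA ler_wpM2r ?exprn_ge0 //.
  rewrite mulrCA ler_wpM2l ?ler0n // -[n.+2]add2n [leRHS]exprD.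
  by rewrite ler_wpM2l ?exprn_ge0 // lerXn2r // nnegrE.
apply: le_trans (_ : r * (n%:R ^+ 2 * r ^+ n * `|h| ^+ 2) +
    n%:R * r ^+ n.+1 * `|h| ^+ 2 <= _).
  apply: le_trans (ler_wpM2l (exprn_ge0 2 r0) (ler_normD _ _)) _.
  rewrite mulrDr lerD // normrM mulrCA.
  by apply: ler_pM => //; rewrite mulr_ge0 // exprn_ge0.
have -> : r * (n%:R ^+ 2 * r ^+ n * `|h| ^+ 2) + n%:R * r ^+ n.+1 * `|h| ^+ 2 =
    (n%:R ^+ 2 + n%:R) * r ^+ n.+1 * `|h| ^+ 2 by rewrite [r ^+ n.+1]exprS; ring.
rewrite ler_wpM2r ?exprn_ge0 // ler_wpM2r ?exprn_ge0 //.
by rewrite -natrX -natrD -natrX ler_nat; nia.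
Qed.

Lemma sqr_le_expn2 n : (n ^ 2 <= 2 * 2 ^ n)%N.
Proof.
have le3 m : (m.+3 ^ 2 <= 2 * 2 ^ m.+3)%N.
  elim: m => // m IH; rewrite expnS [leqRHS]mulnCA.
  by apply: leq_trans (leq_mul (leqnn 2) IH); nia.
by case: n => [|[|[|n]]].
Qed.

Lemma leq_expn2 n : (n <= 2 ^ n)%N.
Proof. exact/ltnW/ltn_expl. Qed.

Lemma sum_expr_half (K : numFieldType) N :
  \sum_(n < N) (2 ^+ n)^-1 <= 2 :> K.
Proof.
suff -> : \sum_(n < N) (2 ^+ n)^-1 = 2 - 2 / 2 ^+ N :> K.
  by rewrite gerBl mulr_ge0 // invr_ge0 exprn_ge0.
elim: N => [|N IH]; first by rewrite big_ord0 expr0 divr1 subrr.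
by rewrite big_ord_recr /= IH exprS; field; rewrite expf_neq0 // pnatr_eq0.
Qed.

Lemma cvg_norm_le (u : nat -> C) (l B : C) :
  u @ \oo --> l -> (forall n, `|u n| <= B) -> `|l| <= B.
Proof.
move=> ul uB; apply/ler_addgt0Pl => e e0.
have /cvgrPdist_le/(_ e e0) /filter_ex[n /= lun] := ul.
by rewrite -[l](subrK (u n)) (le_trans (ler_normD _ _)) // lerD.
Qed.

(** The terms of a series that converges at w are bounded, so on the disc of
radius r = |w| / 4 they are O(4^-n). Both n and n^2 being O(2^n), the derived
series converges there, and summing taylor2_bound gives
|S (z + h) - S z - D z h| = O(|h|^2). The derived series is multiplied by z to
have the same exponents as the original one. *)
Lemma power_series_derive a (w : C) : w != 0 ->
  cvgn (series (fun n => a n * w ^+ n)) ->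
  exists (r : C) (S D : C -> C), [/\ 0 < r,
    forall z, `|z| < r -> series (fun n => a n * z ^+ n) @ \oo --> S z,
    forall z, `|z| < r -> series (fun n => n%:R * a n * z ^+ n) @ \oo --> z * D z &
    forall z, `|z| < r -> is_derive z 1 S (D z)].
Proof.
move=> w0 /cvg_series_cvg_0 aw0.
have [K K0 aK] : exists2 K : R, 0 <= K & forall n, `|a n| * `|w| ^+ n <= K%:C%C.
  have /cvg_seq_bounded/pinfty_ex_gt0[M M0 MP] : cvgn (fun n => a n * w ^+ n).
    by apply/cvg_ex; exists 0.
  exists (complex.Re M) => [|n].
    by rewrite -ler0c RRe_real ?gtr0_real // ltW.
  by rewrite RRe_real ?gtr0_real // -normrX -normrM; exact: MP.
pose r : C := `|w| / 4.
have w_gt0 : 0 < `|w| by rewrite normr_gt0.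
have r0 : 0 < r by rewrite divr_gt0.
have aK4 n : `|a n| * r ^+ n <= (K / 4 ^+ n)%:C%C.
  rewrite /r expr_div_n mulrA rmorphM fmorphV rmorphXn /= rmorph_nat.
  by rewrite ler_wpM2r // invr_ge0 exprn_ge0.
have rE : (complex.Re r)%:C%C = r by apply: RRe_real; exact: gtr0_real.
have aK2 n (k : nat) (z : C) : (k <= 2 ^ n)%N -> `|z| <= r ->
    k%:R * `|a n| * `|z| ^+ n <= (K / 2 ^+ n)%:C%C.
  move=> kn zr.
  apply: le_trans (_ : k%:R * (`|a n| * r ^+ n) <= _).
    rewrite -mulrA; apply: ler_wpM2l; first exact: ler0n.
    apply: ler_wpM2l; first exact: normr_ge0.
    by rewrite lerXn2r ?nnegrE ?normr_ge0 ?(ltW r0).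
  apply: le_trans (ler_pM _ _ (lexx k%:R) (aK4 n)) _ => //.
    by rewrite mulr_ge0 // exprn_ge0 // ltW.
  rewrite !rmorphM !fmorphV !rmorphXn /= !rmorph_nat.
  rewrite mulrCA ler_wpM2l ?ler0c // ler_pdivrMr ?exprn_gt0 //.
  by rewrite -!natrX mulrC ler_pdivlMr ?ltr0n ?expn_gt0 // -natrM ler_nat
    (_ : 4 = 2 * 2)%N // expnMn leq_mul2r kn orbT.
have S_ex z : exists l : C, `|z| < r ->
    series (fun n => a n * z ^+ n) @ \oo --> l.
  have [zr|] := boolP (`|z| < r); last by exists 0.
  have [|l lP] := @cvg_series_half (fun n => a n * z ^+ n) K; last by exists l.
  move=> n; rewrite normrM normrX -[`|a n|]mul1r.
  by apply: (aK2 n 1%N); rewrite ?expn_gt0 // ltW.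
have D_ex z : exists l : C, `|z| < r ->
    series (fun n => n%:R * a n * z ^+ n.-1) @ \oo --> l.
  have [zr|] := boolP (`|z| < r); last by exists 0.
  have [|l lP] := @cvg_series_half (fun n => n%:R * a n * z ^+ n.-1)
      (K / complex.Re r); last by exists l.
  case=> [|n].
    by rewrite !mul0r normr0 ler0c mulr_ge0 // divr_ge0 // -ler0c rE ltW.
  rewrite [K / _ / _]mulrAC rmorphM fmorphV /= rE ler_pdivlMr //=.
  rewrite !normrM normrX normr_nat.
  have rr : `|r| = r by rewrite ger0_norm ?(ltW r0).
  apply: le_trans (aK2 n.+1 n.+1 r (leq_expn2 _) _); last by rewrite rr.
  rewrite rr exprSr mulrA; apply: ler_wpM2r; first exact: ltW.
  apply: ler_wpM2l; first by rewrite mulr_ge0 ?ler0n ?normr_ge0.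
  by rewrite lerXn2r ?nnegrE ?normr_ge0 ?(ltW r0) ?(ltW zr).
have [S SP] := choice S_ex; have [D DP] := choice D_ex.
exists r, S, D; split; [exact: r0|exact: SP|move=> z zr|move=> z zr].
  have -> : series (fun n => n%:R * a n * z ^+ n) =
      fun N => z * series (fun n => n%:R * a n * z ^+ n.-1) N.
    apply/funext => N; rewrite /series /= mulr_sumr; apply: eq_bigr => -[|n] _.
      by rewrite !mul0r mulr0.
    by rewrite exprS /=; ring.
  by apply: cvgMl_tmp; exact: DP.
apply/is_derive_growthP => e e0.
pose B : C := 4 * K%:C%C / r ^+ 2.
have B0 : 0 <= B by rewrite divr_ge0 ?exprn_ge0 ?(ltW r0) // mulr_ge0 ?ler0c.
have bound h : `|z + h| < r -> `|S (z + h) - S z - D z * h| <= B * `|h| ^+ 2.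
  move=> zhr.
  apply: (@cvg_norm_le (fun N => series (fun n => a n * (z + h) ^+ n) N -
    series (fun n => a n * z ^+ n) N -
    series (fun n => n%:R * a n * z ^+ n.-1) N * h)) => [|N].
    apply: (@cvgB C C nat \oo _ (fun N => series (fun n => a n * (z + h) ^+ n) N -
      series (fun n => a n * z ^+ n) N)
      (fun N => series (fun n => n%:R * a n * z ^+ n.-1) N * h)).
      by apply: (@cvgB C C nat \oo _ (series _) (series _)); exact: SP.
    by apply: cvgMr_tmp; exact: DP.
  rewrite /series /= mulr_suml -!sumrB.
  apply: le_trans (ler_norm_sum _ _ _) _.
  apply: le_trans (_ : \sum_(0 <= n < N)
      (2 * K%:C%C / r ^+ 2 * `|h| ^+ 2) * (2 ^+ n)^-1 <= _).
    apply: ler_sum => n _; rewrite -mulrBr.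
    have -> : a n * ((z + h) ^+ n - z ^+ n) - n%:R * a n * z ^+ n.-1 * h =
      a n * ((z + h) ^+ n - z ^+ n - n%:R * z ^+ n.-1 * h) by ring.
    rewrite normrM; have r20 : 0 < r ^+ 2 by rewrite exprn_gt0.
    rewrite -(ler_pM2l r20) mulrCA.
    have zr' : `|z| <= r by exact: ltW.
    have zhr' : `|z + h| <= r by exact: ltW.
    apply: le_trans (ler_wpM2l (normr_ge0 (a n)) (taylor2_bound n zr' zhr')) _.
    have n2 : n%:R ^+ 2 <= 2 * (2 ^ n)%:R :> C.
      by rewrite -natrX -natrM ler_nat sqr_le_expn2.
    have rr : `|r| = r by rewrite ger0_norm ?(ltW r0).
    have := aK2 n (2 ^ n)%N r (leqnn _); rewrite rr => /(_ (lexx _)) ak.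
    have h0 : 0 <= `|h| ^+ 2 by rewrite exprn_ge0.
    have -> : `|a n| * (n%:R ^+ 2 * r ^+ n * `|h| ^+ 2) =
      n%:R ^+ 2 * (`|a n| * r ^+ n * `|h| ^+ 2) by ring.
    apply: le_trans (ler_wpM2r _ n2) _.
      by rewrite mulr_ge0 // mulr_ge0 ?normr_ge0 // exprn_ge0 // ltW.
    have -> : 2 * (2 ^ n)%:R * (`|a n| * r ^+ n * `|h| ^+ 2) =
      2 * ((2 ^ n)%:R * `|a n| * r ^+ n) * `|h| ^+ 2 by ring.
    apply: le_trans (ler_wpM2r h0 (ler_wpM2l _ ak)) _; first exact: ler0n.
    rewrite le_eqVlt; apply/orP; left; apply/eqP.
    rewrite rmorphM fmorphV rmorphXn /= rmorph_nat.
    by field; rewrite expf_neq0 ?pnatr_eq0 //= gt_eqF.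
  rewrite -mulr_sumr big_mkord.
  have B'0 : 0 <= 2 * K%:C%C / r ^+ 2 * `|h| ^+ 2 :> C.
    rewrite mulr_ge0 ?exprn_ge0 ?normr_ge0 // divr_ge0 ?exprn_ge0 ?(ltW r0) //.
    by rewrite mulr_ge0 ?ler0c.
  apply: le_trans (ler_wpM2l B'0 (sum_expr_half _ N)) _.
  by rewrite le_eqVlt; apply/orP; left; apply/eqP; rewrite /B; ring.
have near_r : \forall h \near (0 : C), `|z + h| < r.
  have rz : 0 < r - `|z| by rewrite subr_gt0.
  have := nbhs0_lt (V := C) rz; apply: filterS => h hr.
  apply: le_lt_trans (ler_normD _ _) _.
  by rewrite -(subrKC `|z| r) ltrD2l.
have near_e : \forall h \near (0 : C), `|h| <= e / (B + 1).
  by apply: (nbhs0_le (V := C)); rewrite divr_gt0 // ltr_wpDl.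
near=> h.
apply: le_trans (bound h _) _; first by near: h.
rewrite expr2 mulrA ler_wpM2r ?normr_ge0 //.
have he : `|h| <= e / (B + 1) by near: h.
apply: le_trans (ler_wpM2l B0 he) _.
rewrite mulrCA ler_piMr ?(ltW e0) // ler_pdivrMr ?mul1r ?lerDl // ltr_wpDl //.
Unshelve. all: by end_near. Qed.

End PowerSeries.

(** * Meromorphic functions *)

Section Meromorphic.
Variable R : realType.
Local Notation C := (cplx R).
Implicit Types (f g : C -> C) (t z : C).

Lemma is_derive_translate (S : C -> C) (t t0 l : C) :
  is_derive (t - t0) 1 S l -> is_derive t 1 (fun s => S (s - t0)) l.
Proof.
move=> /is_derive_growthP dS; apply/is_derive_growthP => e e0.
by apply: filterS (dS e e0) => h; rewrite [t - t0 + h]addrAC.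
Qed.

(** The numerator of the Laurent expansion is a power series, whose sum S is
holomorphic across t0 although f is not. *)
Lemma meromorphic_laurent f t0 : meromorphic f ->
  exists (k : nat) (a : nat -> C) (r : C) (S D : C -> C), [/\ 0 < r,
    forall z, `|z| < r -> series (fun n => a n * z ^+ n) @ \oo --> S z,
    forall z, `|z| < r -> series (fun n => n%:R * a n * z ^+ n) @ \oo --> z * D z,
    forall z, `|z| < r -> is_derive z 1 S (D z) &
    forall t, t != t0 -> `|t - t0| < r -> (t - t0) ^+ k * f t = S (t - t0)].
Proof.
move=> /(_ t0)[k [a]]; rewrite near_withinE => /nbhs_ballP[e /= e0 fa].
have {}fa z : z != 0 -> `|z| < e ->
    series (fun n => a n * z ^+ n) @ \oo --> (z ^+ k * f (t0 + z) : C).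
  move=> z0 ze; have tz : t0 + z - t0 = z by rewrite addrAC subrr add0r.
  have := fa (t0 + z); rewrite -[t0 + z == t0]subr_eq0 tz => /(_ _ z0); apply.
  suff : `|t0 - (t0 + z)| < e by [].
  by rewrite opprD addNKr normrN.
have e20 : 0 < e / 2 by rewrite divr_gt0.
have e2 : `|e / 2| < e by rewrite gtr0_norm // gtr_pMr // invf_lt1 // ltr1n.
have e2_neq0 : e / 2 != 0 by rewrite gt_eqF.
have [r [S [D [r0 SP DP dS]]]] := power_series_derive e2_neq0
  (cvgP _ (fa _ e2_neq0 e2)).
have [rho [rho0 rhor rhoe]] : exists rho : C, [/\ 0 < rho, rho <= r & rho <= e].
  have [re|/ltW er] := real_leP (gtr0_real r0) (gtr0_real e0).
    by exists r; split; [exact: r0|exact: lexx|exact: re].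
  by exists e; split; [exact: e0|exact: er|exact: lexx].
exists k, a, rho, S, D; split.
- exact: rho0.
- by move=> z zrho; apply: SP; exact: lt_le_trans zrho rhor.
- by move=> z zrho; apply: DP; exact: lt_le_trans zrho rhor.
- by move=> z zrho; apply: dS; exact: lt_le_trans zrho rhor.
- move=> t tt0 trho.
  have := fa (t - t0); rewrite subr_eq0 [t0 + _]addrC subrK.
  move=> /(_ tt0 (lt_le_trans trho rhoe)) fat.
  have St := SP _ (lt_le_trans trho rhor).
  exact: (cvg_unique (@norm_hausdorff _ _) fat St).
Qed.

Lemma near_punctured (t0 r : C) : 0 < r ->
  \forall t \near t0^', t != t0 /\ `|t - t0| < r.
Proof.
move=> r0; rewrite near_withinE; apply/nbhs_ballP; exists r => // t tr tt0.
by split=> //; rewrite distrC.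
Qed.

(** With z = t - t0 and z^k f = S, differentiation gives
z^(k + 1) f' = z S' - k S, whose coefficients are (n - k) a n. *)
Lemma meromorphic_derive1 f : meromorphic f -> meromorphic (derive1 f).
Proof.
move=> mf t0.
have [k [a [r [S [D [r0 SP DP dS fS]]]]]] := meromorphic_laurent t0 mf.
exists k.+1, (fun n => (n%:R - k%:R) * a n).
have gen := near_punctured t0 r0.
have := dnbhs_interior gen; move: gen; apply: filterS2 => t [tt0 tr] near_t.
have tz0 : t - t0 != 0 by rewrite subr_eq0.
have fE : \forall s \near t, S (s - t0) * ((s - t0) ^+ k)^-1 = f s.
  apply: filterS near_t => s [st0 sr].
  by rewrite -fS // mulrC mulKf // expf_neq0 // subr_eq0.
have dSt := is_derive_translate (dS _ tr).
have did : is_derive t 1 (fun s : C => s - t0) (1 : C).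
  have di : is_derive t 1 (fun s : C => s) (1 : C) by exact: is_derive_id.
  by have := is_derive_add di (is_derive_const t (- t0)); rewrite addr0.
have zk0 : (t - t0) ^+ k != 0 by rewrite expf_neq0.
have df := near_is_derive fE (is_derive_mul dSt
  (@is_derive_inv _ t (fun s => (s - t0) ^+ k) _ zk0 (is_derive_exp k did))).
rewrite (is_derive_derive1E df).
have -> : series (fun n => (n%:R - k%:R) * a n * (t - t0) ^+ n) =
    (fun N => series (fun n => n%:R * a n * (t - t0) ^+ n) N -
       k%:R * series (fun n => a n * (t - t0) ^+ n) N).
  apply/funext => N; rewrite /series /= mulr_sumr -sumrB.
  by apply: eq_bigr => n _; ring.
have -> : (t - t0) ^+ k.+1 * (S (t - t0) *
      (- ((t - t0) ^+ k.-1 *+ k * 1) / (t - t0) ^+ k ^+ 2) +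
      ((t - t0) ^+ k)^-1 * D (t - t0)) =
    (t - t0) * D (t - t0) - k%:R * S (t - t0).
  case: k zk0 {SP DP fS fE df} => [|k] zk0.
    by rewrite /= expr1 mulr0n expr0; field.
  rewrite /= mulr1 -mulr_natl !exprS; field.
  by rewrite expf_neq0 //= tz0.
apply: (@cvgB C C nat \oo _ (fun N => series (fun n => n%:R * a n * (t - t0) ^+ n) N)
  (fun N => k%:R * series (fun n => a n * (t - t0) ^+ n) N)).
  exact: DP.
by apply: cvgMl_tmp; exact: SP.
Qed.

End Meromorphic.

Section SeveralVariables.
Variable R : realType.
Local Notation C := (cplx R).
Local Notation C2 := (C * C)%type.
Local Notation C3 := (C * C * C)%type.

Lemma closure_openI (V : topologicalType) (U A B : set V) :
  open U -> U `<=` closure A -> U `<=` closure B ->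
  (forall x, U x -> A x -> nbhs x A) -> U `<=` closure (A `&` B).
Proof.
move=> Uo UA UB Ao x Ux N Nx.
have [y [Ay [Ny Uy]]] :=
  UA x Ux _ (filterI (nbhs_interior Nx) (open_nbhs_nbhs (conj Uo Ux))).
have [z [Bz [Nz Az]]] := UB y Uy _ (filterI Ny (Ao y Uy Ay)).
by exists z.
Qed.

Lemma near_differentiable_neq0 (V : normedModType C) (h : V -> C) x :
  differentiable h x -> h x != 0 -> nbhs x [set w | h w != 0].
Proof.
by move=> /differentiable_continuous hx h0; exact: (cvgr_neq0 _ hx h0).
Qed.

Lemma meromorphic_differentiable (V : normedModType C) (F : V -> C) :
  (forall x, differentiable F x) -> meromorphic_nvar F.
Proof.
move=> dF x; exists setT, F, (fun=> 1); split.
- by split => //; exact: openT.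
- by move=> w _; split; [exact: dF|exact: differentiable_cst].
- by move=> w _; apply: subset_closure => /=; exact: oner_neq0.
- by move=> w _ _; rewrite divr1.
Qed.

(** Sums and products reduce to a common denominator. The denominators being
continuous, the sets where they do not vanish are open, so that density of each
gives density of the intersection. *)
Lemma meromorphic_op2 (op : C -> C -> C) (num : C -> C -> C -> C -> C)
    (V : normedModType C) (F G : V -> C) :
  (forall a b c d, b != 0 -> d != 0 ->
    op (a / b) (c / d) = num a b c d / (b * d)) ->
  (forall (a b c d : V -> C) x, differentiable a x -> differentiable b x ->
    differentiable c x -> differentiable d x ->
    differentiable (fun w => num (a w) (b w) (c w) (d w)) x) ->
  meromorphic_nvar F -> meromorphic_nvar G ->
  meromorphic_nvar (fun x => op (F x) (G x)).
Proof.
move=> opE dnum mF mG x.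
have [U [g [h [[Uo Ux] dgh Uh FE]]]] := mF x.
have [U' [g' [h' [[U'o U'x] dgh' U'h GE]]]] := mG x.
exists (U `&` U'), (fun w => num (g w) (h w) (g' w) (h' w)), (fun w => h w * h' w).
split.
- by split; [exact: openI|split].
- move=> w [/dgh[dg dh] /dgh'[dg' dh']]; split; first exact: dnum.
  exact: differentiableM.
- have sub : U `&` U' `<=` closure ([set w | h w != 0] `&` [set w | h' w != 0]).
    apply: closure_openI; first exact: openI.
    + by move=> w [/Uh].
    + by move=> w [_ /U'h].
    + by move=> w [/dgh[_ dh] _]; exact: near_differentiable_neq0.
  move=> w /sub; apply: closureS => y [hy hy'] /=.
  by rewrite mulf_neq0.
- move=> w [Uw U'w]; rewrite mulf_eq0 negb_or => /andP[hw hw'].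
  by rewrite FE // GE // opE.
Qed.

Lemma meromorphic_add (V : normedModType C) (F G : V -> C) :
  meromorphic_nvar F -> meromorphic_nvar G -> meromorphic_nvar (fun x => F x + G x).
Proof.
apply: (@meromorphic_op2 _ (fun a b c d => a * d + c * b)).
  by move=> a b c d b0 d0; field; rewrite b0 d0.
by move=> a b c d x *; apply: differentiableD; apply: differentiableM.
Qed.

Lemma meromorphic_mul (V : normedModType C) (F G : V -> C) :
  meromorphic_nvar F -> meromorphic_nvar G -> meromorphic_nvar (fun x => F x * G x).
Proof.
apply: (@meromorphic_op2 _ (fun a b c d => a * c)).
  by move=> a b c d b0 d0; field; rewrite b0 d0.
by move=> a b c d x *; apply: differentiableM.
Qed.

(** If F = g / h, the inverse is taken as h^2 / (g h): where this denominator does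
not vanish, F is indeed g / h. *)
Lemma meromorphic_inv (V : normedModType C) (F : V -> C) :
  dense [set x | F x != 0] -> meromorphic_nvar F ->
  meromorphic_nvar (fun x => (F x)^-1).
Proof.
move=> F0 mF x; have [U [g [h [[Uo Ux] dgh Uh FE]]]] := mF x.
exists U, (fun w => h w * h w), (fun w => g w * h w); split.
- by split.
- by move=> w /dgh[dg dh]; split; exact: differentiableM.
- have sub : U `<=` closure ([set w | h w != 0] `&` ([set w | F w != 0] `&` U)).
    apply: closure_openI => //.
    + move=> w Uw N Nw.
      have [y [[Ny Uy] Fy]] : (N° `&` U) `&` [set x | F x != 0] !=set0.
        apply: F0; last by apply: openI => //; exact: open_interior.
        by exists w; split => //; exact: nbhs_interior.
      by exists y; split => //; exact: interior_subset.
    + by move=> w /dgh[_ dh]; exact: near_differentiable_neq0.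
  move=> w /sub; apply: closureS => y [hy [Fy Uy]] /=.
  rewrite mulf_neq0 //; apply: contra_neq Fy => gy.
  by rewrite FE // gy mul0r.
- move=> w Uw; rewrite mulf_eq0 negb_or => /andP[gw hw].
  by rewrite FE //; field; rewrite gw hw.
Qed.

Lemma differentiable_exp (V : normedModType C) (F : V -> C) n x :
  differentiable F x -> differentiable (fun w => F w ^+ n) x.
Proof.
move=> dF; elim: n => [|n IH]; first exact: differentiable_cst.
by under eq_fun do rewrite exprS; exact: differentiableM.
Qed.

(** The quotient is (t - t0) S / (t - t0)^(k + 1). The additional factor makes the
denominator vanish at t0 even for k = 0, as the value of f there is
arbitrary. *)
Lemma meromorphic_pole (f : C -> C) :
  meromorphic f -> meromorphic_nvar (f : (C : normedModType C) -> C).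
Proof.
move=> mf t0; have [k [a [r [S [D [r0 SP DP dS fS]]]]]] := meromorphic_laurent t0 mf.
exists (ball t0 r), (fun t => (t - t0) * S (t - t0)), (fun t => (t - t0) ^+ k.+1).
have dsub (t : C) : differentiable (fun s : C => s - t0) t.
  apply: (@differentiableB _ C C id (cst t0)); first exact: ex_diff.
  exact: differentiable_cst.
split.
- by split; [exact: ball_open|exact: ballxx].
- move=> t tr; split; last by apply: differentiable_exp; exact: dsub.
  apply: differentiableM; first exact: dsub.
  apply/derivable1_diffP; apply: (is_derive_derivable (a := D (t - t0))).
  by apply: is_derive_translate; apply: dS; rewrite distrC.
- move=> t _ N Nt.
  have : \forall s \near t^', N s /\ s != t0.
    near=> s; split; near: s; first exact: nbhs_dnbhs.
    exact: dnbhs_neq.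
  move=> /filter_ex[s [Ns st0]]; exists s; split => //=.
  by rewrite expf_neq0 // subr_eq0.
- move=> t tr; rewrite expf_eq0 /= subr_eq0 => tt0.
  have tz0 : t - t0 != 0 by rewrite subr_eq0.
  rewrite -fS ?(distrC t) // exprS; field.
  by rewrite tz0 expf_neq0.
Unshelve. all: by end_near. Qed.

(** Multiplying numerator and denominator by t - t0 discards the point t0, where
the two functions may differ. *)
Lemma meromorphic_generic_eq (f g : C -> C) :
  generically (fun t => f t = g t) ->
  meromorphic_nvar (f : (C : normedModType C) -> C) ->
  meromorphic_nvar (g : (C : normedModType C) -> C).
Proof.
move=> fg mf t0; have [U [a [b [[Uo Ut0] dab Ub fE]]]] := mf t0.
have := fg t0; rewrite near_withinE => /nbhs_interior fg0.
pose V : set C := U `&` (fun t => t != t0 -> f t = g t)°.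
have Vo : open V by apply: openI; [exact: Uo|exact: open_interior].
exists V, (fun t => a t * (t - t0)), (fun t => b t * (t - t0)).
have dsub (t : C) : differentiable (fun s : C => s - t0) t.
  apply: (@differentiableB _ C C id (cst t0)); first exact: ex_diff.
  exact: differentiable_cst.
split.
- by split; [exact: Vo|split; [exact: Ut0|exact: nbhs_singleton]].
- by move=> t [/dab[da db] _]; split; apply: differentiableM;
    by [exact: da|exact: db|exact: dsub].
- have sub : V `<=` closure ([set t | b t != 0] `&` [set t | t != t0]).
    apply: closure_openI; first exact: Vo.
    + by move=> t [/Ub].
    + move=> t _ N Nt.
      have : \forall s \near t^', N s /\ s != t0.
        near=> s; split; near: s; first exact: nbhs_dnbhs.
        exact: dnbhs_neq.
      by move=> /filter_ex[s [Ns st0]]; exists s.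
    + by move=> t [/dab[_ db] _]; exact: near_differentiable_neq0.
  move=> t /sub; apply: closureS => s [bs st0] /=.
  by rewrite mulf_neq0 // subr_eq0.
- move=> t [Ut /interior_subset fgt]; rewrite mulf_eq0 negb_or subr_eq0.
  move=> /andP[bt tt0]; have tz0 : t - t0 != 0 by rewrite subr_eq0.
  by rewrite -fgt // fE //; field; rewrite bt tz0.
Unshelve. all: by end_near. Qed.

Lemma differentiable_fst (V W : normedModType C) (x : V * W) :
  differentiable (fst : V * W -> V) x.
Proof.
apply: (@linear_differentiable C _ _ (fst : {linear (V * W)%type -> V})).
by case=> a b; apply: (@cvg_fst _ _ (nbhs a) (nbhs b)).
Qed.

Lemma differentiable_snd (V W : normedModType C) (x : V * W) :
  differentiable (snd : V * W -> W) x.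
Proof.
apply: (@linear_differentiable C _ _ (snd : {linear (V * W)%type -> W})).
by case=> a b; apply: (@cvg_snd _ _ (nbhs a) (nbhs b)).
Qed.

Lemma meromorphic_snd (V : normedModType C) (q : C -> C) :
  meromorphic_nvar (q : (C : normedModType C) -> C) ->
  meromorphic_nvar (fun x : V * C => q x.2).
Proof.
move=> mq x; have [U [g [h [[Uo Ux] dgh Uh qE]]]] := mq x.2.
exists (snd @^-1` U), (g \o snd), (h \o snd); split.
- split => //; apply: open_comp => // y _.
  exact/differentiable_continuous/differentiable_snd.
- move=> w /dgh[dg dh]; split; apply: differentiable_comp => //;
    exact: differentiable_snd.
- move=> [v t] Ut N [[A B] [/= Av Bt] ABN].
  have [s [hs Bs]] := Uh t Ut B Bt.
  by exists (v, s); split => //; apply: ABN; split => //; exact: nbhs_singleton.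
- by move=> w Uw; exact: qE.
Qed.

End SeveralVariables.

(** * Polynomials and rational maps in two variables *)

Section Polynomials.
Variable R : realType.
Local Notation C := (cplx R).
Local Notation C2 := (C * C)%type.
Implicit Types (P Q : {poly {poly C}}) (x y w : C2) (F G N : C2 -> C).

Definition polyfun F := exists P, forall x, eval2 P x = F x.

Lemma eval2D P Q x : eval2 (P + Q) x = eval2 P x + eval2 Q x.
Proof. by rewrite /eval2 !hornerD. Qed.

Lemma eval2M P Q x : eval2 (P * Q) x = eval2 P x * eval2 Q x.
Proof. by rewrite /eval2 !hornerM. Qed.

Lemma eval2_exp P n x : eval2 (P ^+ n) x = eval2 P x ^+ n.
Proof. by rewrite /eval2 !horner_exp. Qed.

Lemma eval2_0 x : eval2 0 x = 0.
Proof. by rewrite /eval2 !horner0. Qed.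

Lemma polyfun_eval2 P : polyfun (eval2 P).
Proof. by exists P. Qed.

Lemma polyfun_const (c : C) : polyfun (fun=> c).
Proof. by exists c%:P%:P => x; rewrite /eval2 !hornerC. Qed.

Lemma polyfun_fst : polyfun (fun x => x.1).
Proof. by exists ('X%:P) => x; rewrite /eval2 hornerC hornerX. Qed.

Lemma polyfun_snd : polyfun (fun x => x.2).
Proof. by exists 'X => x; rewrite /eval2 hornerX hornerC. Qed.

Lemma polyfun_add F G : polyfun F -> polyfun G -> polyfun (fun x => F x + G x).
Proof. by move=> [P PF] [Q QG]; exists (P + Q) => x; rewrite eval2D PF QG. Qed.

Lemma polyfun_mul F G : polyfun F -> polyfun G -> polyfun (fun x => F x * G x).
Proof. by move=> [P PF] [Q QG]; exists (P * Q) => x; rewrite eval2M PF QG. Qed.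

Lemma polyfun_opp F : polyfun F -> polyfun (fun x => - F x).
Proof.
move=> [P PF]; exists (- P) => x.
by rewrite -(PF x) /eval2 !hornerN.
Qed.

Lemma polyfun_exp n F : polyfun F -> polyfun (fun x => F x ^+ n).
Proof. by move=> [P PF]; exists (P ^+ n) => x; rewrite eval2_exp PF. Qed.

Lemma rational_off_frac Q F N : polyfun N ->
  (forall x, eval2 Q x != 0 -> F x = N x / eval2 Q x) -> rational_off Q F.
Proof. by move=> [P PN] FE; exists P => x Qx; rewrite PN FE. Qed.

Lemma eval2_line Q x w :
  exists p : {poly C}, forall s, p.[s] = eval2 Q (x.1 + w.1 * s, x.2 + w.2 * s).
Proof.
elim/poly_ind: Q => [|Q q [p pE]]; first by exists 0 => s; rewrite horner0 eval2_0.
exists (p * (x.2%:P + w.2 *: 'X) + (q \Po (x.1%:P + w.1 *: ('X)))) => s.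
rewrite eval2D eval2M -pE hornerD hornerM horner_comp.
rewrite !(hornerD, hornerZ, hornerX, hornerC) /eval2 /= hornerX !hornerC //.
Qed.

(** The numbers e / 2, e / 3, and so on are too many to be all roots of p. *)
Lemma poly_nonroot_near0 (p : {poly C}) (e : C) : p != 0 -> 0 < e ->
  exists2 s : C, `|s| < e & p.[s] != 0.
Proof.
move=> p0 e0; apply: contrapT => noroot.
pose pts : seq C := [seq e / k.+2%:R | k <- iota 0 (size p)].
have allroot : all (root p) pts.
  apply/allP => _ /mapP[k _ ->]; apply/negPn/negP => pk; apply: noroot.
  exists (e / k.+2%:R) => //.
  by rewrite gtr0_norm ?divr_gt0 // gtr_pMr // invf_lt1 // ltr1n.
have pts_uniq : uniq pts.
  rewrite map_inj_uniq ?iota_uniq // => k l /(mulfI (lt0r_neq0 e0)) /invr_inj /eqP.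
  by rewrite eqr_nat => /eqP[].
have := max_poly_roots p0 allroot pts_uniq.
by rewrite size_map size_iota ltnn.
Qed.

Lemma eval2_nonzero Q : Q != 0 -> exists x, eval2 Q x != 0.
Proof.
move=> Q0.
have [c Qc] : exists c : C, Q.[c%:P] != 0.
  apply: contrapT => noroot.
  pose pts : seq {poly C} := [seq (k%:R : C)%:P | k <- iota 0 (size Q)].
  have allroot : all (root Q) pts.
    apply/allP => _ /mapP[k _ ->]; apply/negPn/negP => pk; apply: noroot.
    by exists k%:R.
  have pts_uniq : uniq pts.
    rewrite map_inj_uniq ?iota_uniq // => k l /polyC_inj /eqP.
    by rewrite eqr_nat => /eqP.
  have := max_poly_roots Q0 allroot pts_uniq.
  by rewrite size_map size_iota ltnn.
have [s _ Qs] := poly_nonroot_near0 Qc (@ltr01 C).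
by exists (s, c).
Qed.

Lemma eval2_neq0 Q x : eval2 Q x != 0 -> Q != 0.
Proof. by apply: contra_neq => ->; rewrite eval2_0. Qed.

(** On the complex line from x to a point where Q does not vanish, Q is a nonzero
polynomial in one variable, with only finitely many zeros. *)
Lemma eval2_dense Q : Q != 0 -> dense [set x : C2 | eval2 Q x != 0].
Proof.
move=> /eval2_nonzero[y Qy] O [x Ox] Oo.
have [p pE] := eval2_line Q x (y.1 - x.1, y.2 - x.2).
have p0 : p != 0.
  apply: contra_neq Qy => p0; have := pE 1.
  by rewrite p0 horner0 /= !mulr1 !subrKC -surjective_pairing => <-.
have line_cvg (a b : C) : a + b * s @[s --> (0 : C)] --> a.
  have bs : b * s @[s --> nbhs (0 : C)] --> (0 : C).
    by rewrite -[X in _ --> X](mulr0 b); apply: cvgMl_tmp; exact: cvg_id.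
  have := @cvgD C C C (nbhs (0 : C)) _ (cst a) (fun s => b * s) a 0 _ bs.
  by rewrite addr0; apply; exact: (@cvg_cst C).
have Onbhs : \forall s \near (0 : C), O (x.1 + (y.1 - x.1) * s, x.2 + (y.2 - x.2) * s).
  have : nbhs (x.1, x.2) O.
    by apply: open_nbhs_nbhs; split=> //; rewrite -surjective_pairing.
  move=> [[A B] [/= Ax Bx] AB].
  have As := line_cvg x.1 (y.1 - x.1) _ Ax.
  have Bs := line_cvg x.2 (y.2 - x.2) _ Bx.
  near=> s; apply: AB; split => /=; near: s; [exact: As|exact: Bs].
move: Onbhs => /nbhs_ballP[e /= e0 eO].
have [s se ps] := poly_nonroot_near0 p0 e0.
exists (x.1 + (y.1 - x.1) * s, x.2 + (y.2 - x.2) * s); split.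
  apply: eO; suff : `|0 - s| < e by [].
  by rewrite sub0r normrN.
by rewrite /= -pE.
Unshelve. all: by end_near. Qed.

(** Fractions whose denominator is any power of Q: unlike rational_off Q, they are
closed under sums and products, hence under composition with a polynomial. *)
Definition poly_frac Q F := exists n N, polyfun N /\
  forall x, eval2 Q x != 0 -> F x * eval2 Q x ^+ n = N x.

Lemma poly_frac_const Q c : poly_frac Q (fun=> c).
Proof.
exists 0%N, (fun=> c); split; first exact: polyfun_const.
by move=> x _; rewrite expr0 mulr1.
Qed.

Lemma poly_frac_rational Q F : rational_off Q F -> poly_frac Q F.
Proof.
move=> [P PF]; exists 1%N, (eval2 P); split; first exact: polyfun_eval2.
by move=> x Qx; rewrite PF // expr1 divfK.
Qed.

Lemma poly_frac_add Q F G :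
  poly_frac Q F -> poly_frac Q G -> poly_frac Q (fun x => F x + G x).
Proof.
move=> [n [M [Mp MF]]] [m [N [Np NG]]].
exists (n + m)%N, (fun x => M x * eval2 Q x ^+ m + N x * eval2 Q x ^+ n); split.
  by apply: polyfun_add; apply: polyfun_mul => //; apply: polyfun_exp;
    exact: polyfun_eval2.
by move=> x Qx; rewrite -MF // -NG // exprD; ring.
Qed.

Lemma poly_frac_mul Q F G :
  poly_frac Q F -> poly_frac Q G -> poly_frac Q (fun x => F x * G x).
Proof.
move=> [n [M [Mp MF]]] [m [N [Np NG]]].
exists (n + m)%N, (fun x => M x * N x); split; first exact: polyfun_mul.
by move=> x Qx; rewrite -MF // -NG // exprD; ring.
Qed.

Lemma poly_frac_eval2 Q P (phi : C2 -> C2) :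
  poly_frac Q (fun x => (phi x).1) -> poly_frac Q (fun x => (phi x).2) ->
  poly_frac Q (fun x => eval2 P (phi x)).
Proof.
move=> phi1 phi2; elim/poly_ind: P => [|P p IH].
  by under eq_fun do rewrite eval2_0; exact: poly_frac_const.
have -> : (fun x => eval2 (P * 'X + p%:P) (phi x)) =
    fun x => eval2 P (phi x) * (phi x).2 + p.[(phi x).1].
  by apply/funext => x; rewrite eval2D eval2M /eval2 hornerX !hornerC.
apply: poly_frac_add; first exact: poly_frac_mul.
elim/poly_ind: p => [|p c IHp].
  by under eq_fun do rewrite horner0; exact: poly_frac_const.
under eq_fun do rewrite hornerMXaddC.
by apply: poly_frac_add (poly_frac_const _ _); exact: poly_frac_mul.
Qed.

(** On the set Q1 <> 0 the polynomial Q2 composed with phi is S / Q1^m, so the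
composite is defined where Q1 and S do not vanish. The high power of Q1 in Q is a
common denominator for both components. *)
Lemma rational_off_comp Q1 Q2 (phi psi : C2 -> C2) :
  rational_off Q1 (fun x => (phi x).1) -> rational_off Q1 (fun x => (phi x).2) ->
  rational_off Q2 (fun x => (psi x).1) -> rational_off Q2 (fun x => (psi x).2) ->
  exists Q, [/\
    forall x, eval2 Q x != 0 <-> eval2 Q1 x != 0 /\ eval2 Q2 (phi x) != 0,
    rational_off Q (fun x => (psi (phi x)).1) &
    rational_off Q (fun x => (psi (phi x)).2)].
Proof.
move=> /poly_frac_rational f1 /poly_frac_rational f2 [P1 P1E] [P2 P2E].
have [n1 [N1 [N1p N1E]]] := poly_frac_eval2 P1 f1 f2.
have [n2 [N2 [N2p N2E]]] := poly_frac_eval2 P2 f1 f2.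
have [m [N [[S SN] NE]]] := poly_frac_eval2 Q2 f1 f2.
pose Q := Q1 ^+ (n1 + n2).+1 * S.
have QE x : eval2 Q x != 0 <-> eval2 Q1 x != 0 /\ eval2 Q2 (phi x) != 0.
  rewrite /Q eval2M eval2_exp SN mulf_eq0 negb_or expf_eq0 /=; split.
    move=> /andP[Q1x]; rewrite -NE // mulf_eq0 negb_or => /andP[Q2x _].
    by split.
  by move=> [Q1x Q2x]; rewrite Q1x -NE //= mulf_neq0 // expf_neq0.
have fracE (a b q : C) (n n' : nat) : b != 0 -> q != 0 ->
    a / b = a * q ^+ n * q ^+ n'.+1 * q ^+ m / (q ^+ (n + n').+1 * (b * q ^+ m)).
  move=> b0 q0; rewrite -addnS exprD.
  by field; rewrite ?b0 ?q0 ?expf_neq0.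
exists Q; split => //.
- apply: (@rational_off_frac _ _
    (fun x => N1 x * eval2 Q1 x ^+ n2.+1 * eval2 Q1 x ^+ m)) => [|x /QE[Q1x Q2x]].
    by apply: polyfun_mul; [apply: polyfun_mul => //|]; apply: polyfun_exp;
      exact: polyfun_eval2.
  by rewrite P1E // /Q eval2M eval2_exp SN -NE // -N1E //; exact: fracE.
- apply: (@rational_off_frac _ _
    (fun x => N2 x * eval2 Q1 x ^+ n1.+1 * eval2 Q1 x ^+ m)) => [|x /QE[Q1x Q2x]].
    by apply: polyfun_mul; [apply: polyfun_mul => //|]; apply: polyfun_exp;
      exact: polyfun_eval2.
  by rewrite P2E // /Q eval2M eval2_exp SN -NE // -N2E // addnC; exact: fracE.
Qed.

End Polynomials.

(** * An equivalence relation implying birational equivalence *)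

Section Equivalence.
Variable R : realType.
Local Notation C := (cplx R).
Local Notation C2 := (C * C)%type.
Local Notation C3 := (C * C * C)%type.
Implicit Types (W V : set C3) (T : set C) (F G : C3 -> C) (xi eta chi : C3 -> C2)
  (S : system R) (q : C -> C).

(** Meromorphic after every meromorphic substitution that maps a dense set into W.
Such a substitution cannot turn a function without zeros on W into one that
vanishes on an open set, so that its inverse stays meromorphic too. *)
Definition stable W F := forall V chi, dense V ->
  (forall x, V x -> W (over_t chi x)) ->
  meromorphic_nvar (fun x => (chi x).1) ->
  meromorphic_nvar (fun x => (chi x).2) ->
  meromorphic_nvar (fun x => F (over_t chi x)).

Definition regular W F := (forall x, W x -> differentiable F x) /\ stable W F.

Lemma regular_const W (c : C) : regular W (fun=> c).
Proof.
split=> [x _|V chi _ _ _ _]; first exact: differentiable_cst.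
by apply: meromorphic_differentiable => x; exact: differentiable_cst.
Qed.

Lemma regular_fst W : regular W (fun x => x.1.1).
Proof.
split=> [x _|V chi _ _ m1 _]; last exact: m1.
apply: (@differentiable_comp C C3 C2 C fst fst); exact: differentiable_fst.
Qed.

Lemma regular_snd W : regular W (fun x => x.1.2).
Proof.
split=> [x _|V chi _ _ _ m2]; last exact: m2.
apply: (@differentiable_comp C C3 C2 C fst snd).
  exact: differentiable_fst.
exact: differentiable_snd.
Qed.

Lemma regular_coef W q :
  (forall x, W x -> derivable q x.2 1) ->
  meromorphic_nvar (q : (C : normedModType C) -> C) ->
  regular W (fun x => q x.2).
Proof.
move=> dq mq; split=> [x Wx|V chi _ _ _ _]; last exact: meromorphic_snd.
apply: (@differentiable_comp C C3 C C snd q); first exact: differentiable_snd.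
by apply/derivable1_diffP; exact: dq.
Qed.

Lemma regular_add W F G : regular W F -> regular W G ->
  regular W (fun x => F x + G x).
Proof.
move=> [dF mF] [dG mG]; split=> [x Wx|V chi Vd VW m1 m2].
  by apply: differentiableD; [exact: dF|exact: dG].
by apply: meromorphic_add; [exact: (mF V)|exact: (mG V)].
Qed.

Lemma regular_mul W F G : regular W F -> regular W G ->
  regular W (fun x => F x * G x).
Proof.
move=> [dF mF] [dG mG]; split=> [x Wx|V chi Vd VW m1 m2].
  by apply: differentiableM; [exact: dF|exact: dG].
by apply: meromorphic_mul; [exact: (mF V)|exact: (mG V)].
Qed.

Lemma regular_opp W F : regular W F -> regular W (fun x => - F x).
Proof.
move=> rF; under eq_fun do rewrite -mulN1r.
by apply: regular_mul => //; exact: regular_const.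
Qed.

Lemma regular_exp W F n : regular W F -> regular W (fun x => F x ^+ n).
Proof.
move=> rF; elim: n => [|n IH].
  by under eq_fun do rewrite expr0; exact: regular_const.
by under eq_fun do rewrite exprS; exact: regular_mul.
Qed.

Lemma regular_inv W F : (forall x, W x -> F x != 0) -> regular W F ->
  regular W (fun x => (F x)^-1).
Proof.
move=> F0 [dF mF]; split=> [x Wx|V chi Vd VW m1 m2].
  by apply: differentiableV; [exact: dF|exact: F0].
apply: meromorphic_inv; last exact: (mF V).
move=> O O0 Oo; have [x [Ox Vx]] := Vd O O0 Oo.
by exists x; split => //; apply: F0; exact: VW.
Qed.

Lemma differentiable_over_t W xi x : W x ->
  regular W (fun x => (xi x).1) -> regular W (fun x => (xi x).2) ->
  differentiable xi x /\ differentiable (over_t xi) x.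
Proof.
move=> Wx [d1 _] [d2 _].
have dxi : differentiable xi x.
  have -> : xi = fun x => ((xi x).1, (xi x).2).
    by apply/funext => y; case: (xi y).
  by apply: differentiable_pair; [exact: d1|exact: d2].
split=> //; apply: differentiable_pair => //; exact: differentiable_snd.
Qed.

(** A substitution into the composite is the composite of two substitutions. *)
Lemma regular_comp W V F xi : regular W (fun x => (xi x).1) ->
  regular W (fun x => (xi x).2) -> regular V F ->
  regular (W `&` over_t xi @^-1` V) (fun x => F (over_t xi x)).
Proof.
move=> r1 r2 [dF mF]; split=> [x [Wx Vx]|U chi Ud UWV m1 m2].
  have [_ dxi] := differentiable_over_t Wx r1 r2.
  exact: (differentiable_comp dxi (dF _ Vx)).
have UW x : U x -> W (over_t chi x) by move=> /UWV[].
apply: (mF U (xi \o over_t chi) Ud).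
- by move=> x /UWV[].
- exact: (r1.2 U chi Ud UW m1 m2).
- exact: (r2.2 U chi Ud UW m1 m2).
Qed.

(** Naming the inverse G makes the notion symmetric. *)
Definition birational_pair (F G : C2 -> C2) :=
  exists (Q Q' : {poly {poly C}}),
    [/\ Q != 0 /\ Q' != 0,
        rational_off Q (fun x => (F x).1) /\ rational_off Q (fun x => (F x).2),
        rational_off Q' (fun x => (G x).1) /\
        rational_off Q' (fun x => (G x).2),
        forall x, eval2 Q x != 0 -> eval2 Q' (F x) != 0 /\ G (F x) = x &
        forall x, eval2 Q' x != 0 -> eval2 Q (G x) != 0 /\ F (G x) = x].

Lemma birational_pairS (F G : C2 -> C2) : birational_pair F G -> birational_pair G F.
Proof. by move=> [Q [Q' [[? ?] ? ? ? ?]]]; exists Q', Q; split. Qed.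

(** The composite is defined somewhere because the two nonempty Zariski open sets
Q1' <> 0 and Q2 <> 0 of the plane in the middle meet. *)
Lemma birational_pair_comp (F1 G1 F2 G2 : C2 -> C2) :
  birational_pair F1 G1 -> birational_pair F2 G2 ->
  birational_pair (F2 \o F1) (G1 \o G2).
Proof.
move=> [Q1 [Q1' [[Q10 Q1'0] [F11 F12] [G11 G12] FG1 GF1]]].
move=> [Q2 [Q2' [[Q20 Q2'0] [F21 F22] [G21 G22] FG2 GF2]]].
have [Q [QE rF1 rF2]] := rational_off_comp F11 F12 F21 F22.
have [Q' [Q'E rG1 rG2]] := rational_off_comp G21 G22 G11 G12.
have [y] := eval2_nonzero (mulf_neq0 Q1'0 Q20).
rewrite eval2M mulf_eq0 negb_or => /andP[Q1'y Q2y].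
have [Q1y Fy] := GF1 _ Q1'y; have [Q2'y Gy] := FG2 _ Q2y.
exists Q, Q'; split.
- split; first by apply: (@eval2_neq0 _ _ (G1 y)); apply/QE; rewrite Fy.
  by apply: (@eval2_neq0 _ _ (F2 y)); apply/Q'E; rewrite Gy.
- by split.
- by split.
- move=> x /QE[/FG1[Q1'x Gx] /FG2[Q2'x G2x]] /=; rewrite G2x; split=> //.
  by apply/Q'E; rewrite G2x.
- move=> x /Q'E[/GF2[Q2x Fx] /GF1[Q1x F1x]] /=; rewrite F1x; split=> //.
  by apply/QE; rewrite F1x.
Qed.

(** Birational equivalence with maps that are regular, not just meromorphic: this
is what makes the relation transitive. *)
Definition strongly_equivalent S S' := exists xi eta W W',
  [/\ open W /\ dense W, open W' /\ dense W',
      [/\ regular W (fun x => (xi x).1), regular W (fun x => (xi x).2),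
          regular W' (fun x => (eta x).1) & regular W' (fun x => (eta x).2)],
      (forall x, W x -> W' (over_t xi x) /\ over_t eta (over_t xi x) = x) /\
      (forall x, W' x -> W (over_t eta x) /\ over_t xi (over_t eta x) = x) &
      [/\ generically (fun t =>
            birational_pair (fun z => xi (z, t)) (fun z => eta (z, t))),
          maps_solutions W xi S S' & maps_solutions W' eta S' S]].

Lemma strongly_equivalentS S S' :
  strongly_equivalent S S' -> strongly_equivalent S' S.
Proof.
move=> [xi [eta [W [W' [oW oW' [r1 r2 r3 r4] [WW' W'W] [b m m']]]]]].
exists eta, xi, W', W; split => //; split => //.
by apply: sub_generically b => t; exact: birational_pairS.
Qed.

Lemma regular_meromorphic W F : dense W -> regular W F -> meromorphic_nvar F.
Proof.
move=> Wd [_ mF].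
have -> : F = fun x => F (over_t fst x) by apply/funext => -[].
apply: (mF W) => //.
- by case.
- by apply: meromorphic_differentiable => x; apply: (regular_fst setT).1.
- by apply: meromorphic_differentiable => x; apply: (regular_snd setT).1.
Qed.

Lemma strongly_equivalentW S S' :
  strongly_equivalent S S' -> birationally_equivalent S S'.
Proof.
move=> [xi [eta [W [W' [[oW dW] [oW' dW'] [r1 r2 r3 r4] [WW' W'W] [b m m']]]]]].
exists xi, eta, W, W'; split => //.
  split => //.
  - by split; apply: (regular_meromorphic dW).
  - by split; apply: (regular_meromorphic dW').
  - split=> [x Wx|x W'x].
      have [? ?] := WW' x Wx; split => //.
      by have [] := differentiable_over_t Wx r1 r2.
    have [? ?] := W'W x W'x; split => //.
    by have [] := differentiable_over_t W'x r3 r4.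
apply: sub_generically b => t [Q [Q' bQ]].
by exists (fun z => eta (z, t)), Q, Q'.
Qed.

Lemma strongly_equivalent_refl S : strongly_equivalent S S.
Proof.
exists fst, fst, setT, setT.
have dT : dense (setT : set C3) by move=> O [x Ox] _; exists x.
split; [by split => //; exact: openT|by split => //; exact: openT| | |].
- by split; [exact: regular_fst|exact: regular_snd
    |exact: regular_fst|exact: regular_snd].
- by split; case.
- split=> //; apply: generically_everywhere => t.
  exists 1, 1; rewrite oner_neq0; split => //.
  + by split; [exists ('X%:P)|exists 'X] => x _;
      rewrite /eval2 ?hornerX !hornerC ?hornerX divr1.
  + by split; [exists ('X%:P)|exists 'X] => x _;
      rewrite /eval2 ?hornerX !hornerC ?hornerX divr1.
Qed.

Lemma open_over_t_preimage W V xi : open W -> open V ->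
  regular W (fun x => (xi x).1) -> regular W (fun x => (xi x).2) ->
  open (W `&` over_t xi @^-1` V).
Proof.
move=> Wo Vo r1 r2; rewrite openE => x [Wx Vx].
have [_ /differentiable_continuous dxi] := differentiable_over_t Wx r1 r2.
apply: filterI; first exact: open_nbhs_nbhs.
by apply: dxi; exact: open_nbhs_nbhs.
Qed.

(** The map over_t xi is a homeomorphism from W onto W', with continuous inverse
over_t eta, so it pulls dense sets back to dense sets. *)
Lemma dense_over_t_preimage W W' V xi eta : open W -> dense W -> open W' ->
  dense V ->
  regular W' (fun x => (eta x).1) -> regular W' (fun x => (eta x).2) ->
  (forall x, W x -> W' (over_t xi x) /\ over_t eta (over_t xi x) = x) ->
  (forall x, W' x -> W (over_t eta x) /\ over_t xi (over_t eta x) = x) ->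
  dense (W `&` over_t xi @^-1` V).
Proof.
move=> Wo Wd W'o Vd r3 r4 WW' W'W O O0 Oo.
have [x [Ox Wx]] := Wd O O0 Oo; have [W'x xE] := WW' x Wx.
have No := open_over_t_preimage W'o (openI Oo Wo) r3 r4.
have [|y [[W'y [Oy Wy]] Vy]] := Vd _ _ No.
  by exists (over_t xi x); split => //=; rewrite xE.
exists (over_t eta y); split => //; split => //=.
by rewrite (W'W y W'y).2.
Qed.

Lemma strongly_equivalent_trans S1 S2 S3 : strongly_equivalent S1 S2 ->
  strongly_equivalent S2 S3 -> strongly_equivalent S1 S3.
Proof.
move=> [xi1 [eta1 [W1 [W1' [[oW1 dW1] [oW1' dW1'] [r1 r2 r3 r4]
  [WW1 W'W1] [b1 m1 m1']]]]]].
move=> [xi2 [eta2 [W2 [W2' [[oW2 dW2] [oW2' dW2'] [s1 s2 s3 s4]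
  [WW2 W'W2] [b2 m2 m2']]]]]].
exists (xi2 \o over_t xi1), (eta1 \o over_t eta2),
  (W1 `&` over_t xi1 @^-1` W2), (W2' `&` over_t eta2 @^-1` W1'); split.
- split; first exact: open_over_t_preimage.
  exact: (dense_over_t_preimage oW1 dW1 oW1' dW2 r3 r4 WW1 W'W1).
- split; first exact: open_over_t_preimage.
  exact: (dense_over_t_preimage oW2' dW2' oW2 dW1' s1 s2 W'W2 WW2).
- by split; [apply: (regular_comp r1 r2 s1)|apply: (regular_comp r1 r2 s2)
    |apply: (regular_comp s3 s4 r3)|apply: (regular_comp s3 s4 r4)].
- split=> [x [W1x W2x]|x [W2x W1x]].
    have [W1'x E1] := WW1 x W1x; have [W2'x E2] := WW2 _ W2x.
    have E : over_t eta2 (over_t (xi2 \o over_t xi1) x) = over_t xi1 x := E2.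
    split; first by split => //=; rewrite E.
    by rewrite -[RHS]E1 -E.
  have [W2'x E2] := W'W2 x W2x; have [W1'x E1] := W'W1 _ W1x.
  have E : over_t xi1 (over_t (eta1 \o over_t eta2) x) = over_t eta2 x := E1.
  split; first by split => //=; rewrite E.
  by rewrite -[RHS]E2 -E.
- split.
  + by apply: sub_generically (generically_and b1 b2) => t [b1t b2t];
      exact: (birational_pair_comp b1t b2t).
  + move=> D zeta Do WD sol; apply: (m2 D (fun t => xi1 (zeta t, t))) => //.
      by move=> t /WD[].
    by apply: m1 => // t /WD[].
  + move=> D zeta Do WD sol; apply: (m1' D (fun t => eta2 (zeta t, t))) => //.
      by move=> t /WD[].
    by apply: m2' => // t /WD[].
Qed.

Definition fraction (d F : C2 -> C) := exists N, polyfun N /\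
  forall z, d z != 0 -> F z = N z / d z.

(** Over an open set T with discrete complement, it is enough to have one
denominator for each map, polynomial on the fibres, such that the two maps
exchange the sets where these denominators do not vanish. *)
Lemma strongly_equivalent_intro T (d d' : C3 -> C) xi eta S S' :
  open T -> generically (fun t => T t) ->
  regular [set x | T x.2] d /\ regular [set x | T x.2] d' ->
  (forall t, T t -> [/\ polyfun (fun z => d (z, t)), polyfun (fun z => d' (z, t)),
     exists z, d (z, t) != 0 & exists z, d' (z, t) != 0]) ->
  (forall t, T t -> [/\ fraction (fun z => d (z, t)) (fun z => (xi (z, t)).1),
    fraction (fun z => d (z, t)) (fun z => (xi (z, t)).2),
    fraction (fun z => d' (z, t)) (fun z => (eta (z, t)).1) &
    fraction (fun z => d' (z, t)) (fun z => (eta (z, t)).2)]) ->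
  let W := [set x | T x.2 /\ d x != 0] in
  let W' := [set x | T x.2 /\ d' x != 0] in
  [/\ regular W (fun x => (xi x).1), regular W (fun x => (xi x).2),
      regular W' (fun x => (eta x).1) & regular W' (fun x => (eta x).2)] ->
  (forall z t, T t -> d (z, t) != 0 ->
     d' (xi (z, t), t) != 0 /\ eta (xi (z, t), t) = z) ->
  (forall z t, T t -> d' (z, t) != 0 ->
     d (eta (z, t), t) != 0 /\ xi (eta (z, t), t) = z) ->
  maps_solutions W xi S S' -> maps_solutions W' eta S' S ->
  strongly_equivalent S S'.
Proof.
move=> To Tg [[dd _] [dd' _]] dpoly dfrac W W' reg toK fromK m m'.
have dT := generically_dense Tg.
have openW (e : C3 -> C) : (forall x, T x.2 -> differentiable e x) ->
    open [set x | T x.2 /\ e x != 0].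
  move=> de; rewrite openE => x [Tx ex]; apply: filterI.
    have /differentiable_continuous : differentiable (snd : C3 -> C) x.
      exact: differentiable_snd.
    by apply; exact: open_nbhs_nbhs.
  by apply: near_differentiable_neq0 => //; exact: de.
have denseW (e : C3 -> C) :
    (forall t, T t -> polyfun (fun z => e (z, t)) /\ exists z, e (z, t) != 0) ->
    dense [set x | T x.2 /\ e x != 0].
  move=> pe O [[z t] Ozt] Oo.
  have [[A B] [/= Az Bt] ABO] : nbhs (z, t) O by exact: open_nbhs_nbhs.
  have [s [/interior_subset Bs Ts]] := dT B° (ex_intro _ t Bt) (@open_interior _ _).
  have [[Q QE] [z0 ez0]] := pe s Ts.
  have Q0 : Q != 0 by apply: (@eval2_neq0 _ _ z0); rewrite QE.
  have [y [/interior_subset Ay Qy]] :=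
    eval2_dense Q0 (ex_intro _ z Az) (@open_interior _ A).
  exists (y, s); split; first exact: ABO.
  by split => //=; rewrite -QE.
exists xi, eta, W, W'; split => //.
- split; first exact: openW.
  by apply: denseW => t /dpoly[].
- split; first exact: openW.
  by apply: denseW => t /dpoly[].
- split=> -[z t] [Tt dt]; rewrite /over_t /=.
    by have [d't ->] := toK z t Tt dt.
  by have [d't ->] := fromK z t Tt dt.
- split=> //; apply: sub_generically Tg => t Tt.
  have [[Q QE] [Q' Q'E] [z0 dz0] [z0' d'z0']] := dpoly t Tt.
  have [[n1 [[N1 NE1] n1E]] [n2 [[N2 NE2] n2E]] [n3 [[N3 NE3] n3E]]
    [n4 [[N4 NE4] n4E]]] := dfrac t Tt.
  exists Q, Q'; split.
  + by split; [apply: (@eval2_neq0 _ _ z0); rewrite QE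
      |apply: (@eval2_neq0 _ _ z0'); rewrite Q'E].
  + by split; [exists N1 => z; rewrite QE NE1; exact: n1E
      |exists N2 => z; rewrite QE NE2; exact: n2E].
  + by split; [exists N3 => z; rewrite Q'E NE3; exact: n3E
      |exists N4 => z; rewrite Q'E NE4; exact: n4E].
  + by move=> z; rewrite QE Q'E; exact: toK.
  + by move=> z; rewrite QE Q'E; exact: fromK.
Qed.

End Equivalence.

(** * Equivalence of each system with its Painleve equation *)

Section Coefficients.
Variable R : realType.
Local Notation C := (cplx R).
Local Notation C2 := (C * C)%type.
Local Notation C3 := (C * C * C)%type.

Definition coefficient (T : set C) (q : C -> C) :=
  (forall t, T t -> derivable q t 1) /\
  meromorphic_nvar (q : (C : normedModType C) -> C).

Lemma regular_coefficient (T : set C) (q : C -> C) (W : set C3) :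
  coefficient T q -> (forall x, W x -> T x.2) -> regular W (fun x => q x.2).
Proof. by move=> [dq mq] WT; apply: regular_coef => // x /WT; exact: dq. Qed.

Lemma coefficient_entire (f : C -> C) :
  (forall t, derivable f t 1) -> coefficient setT f.
Proof.
move=> df; split=> [t _|]; first exact: df.
by apply: meromorphic_differentiable => t; apply/derivable1_diffP; exact: df.
Qed.

Lemma fraction_poly (d F : C2 -> C) : polyfun d -> polyfun F -> fraction d F.
Proof.
move=> pd pF; exists (fun z => F z * d z); split; first exact: polyfun_mul.
by move=> z dz; rewrite mulfK.
Qed.

End Coefficients.

Ltac regular_tac :=
  lazymatch goal with
  | |- regular _ (fun x => x.1.1) => exact: regular_fst
  | |- regular _ (fun x => x.1.2) => exact: regular_snd
  | |- regular _ (fun _ => ?c) => exact: regular_const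
  | |- regular _ (fun x => _ + _) => apply: regular_add; regular_tac
  | |- regular _ (fun x => - _) => apply: regular_opp; regular_tac
  | |- regular _ (fun x => _ * _) => apply: regular_mul; regular_tac
  | |- regular _ (fun x => _ ^+ _) => apply: regular_exp; regular_tac
  | |- regular _ (fun x => (_)^-1) => apply: regular_inv; [|regular_tac]
  | |- regular _ (fun x => ?q x.2) =>
    match goal with H : coefficient _ ?g |- _ =>
      constr_eq g q; apply: (regular_coefficient H); by [move=> ? [] | move=> ?]
    end
  end.

Ltac polyfun_tac :=
  lazymatch goal with
  | |- polyfun fst => exact: polyfun_fst
  | |- polyfun snd => exact: polyfun_snd
  | |- polyfun (fun x => x.1) => exact: polyfun_fst
  | |- polyfun (fun x => x.2) => exact: polyfun_snd
  | |- polyfun (fun _ => ?c) => exact: polyfun_const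
  | |- polyfun (fun x => _ + _) => apply: polyfun_add; polyfun_tac
  | |- polyfun (fun x => - _) => apply: polyfun_opp; polyfun_tac
  | |- polyfun (fun x => _ * _) => apply: polyfun_mul; polyfun_tac
  | |- polyfun (fun x => _ ^+ _) => apply: polyfun_exp; polyfun_tac
  end.

Section Instances.
Variable R : realType.
Local Notation C := (cplx R).
Local Notation C2 := (C * C)%type.
Local Notation C3 := (C * C * C)%type.
Implicit Types (f q r p : C -> C).

Lemma fun3_ext (T : Type) (F G : C3 -> T) :
  (forall y z t, F (y, z, t) = G (y, z, t)) -> F = G.
Proof. by move=> FG; apply/funext => -[[y z] t]. Qed.

Lemma PI_parameter q f : meromorphic q -> generically (cond_q q) ->
  generically (fun t => PI_defect q t = f t) ->
  exists T : set C, [/\ open T, generically (fun t => T t),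
    coefficient T q, coefficient T (derive1 q) &
    forall t, T t -> twice_derivable q t /\ PI_defect q t = f t].
Proof.
move=> mq cq qf; exists [set t | cond_q q t /\ PI_defect q t = f t]°.
split.
- exact: open_interior.
- exact/generically_interior/generically_and.
- by split=> [t /interior_subset[[[]]] //|]; exact: meromorphic_pole.
- split=> [t /interior_subset[[[]]] //|].
  exact/meromorphic_pole/meromorphic_derive1.
- by move=> t /interior_subset[[]].
Qed.

Lemma IXB2_equivalent q f : meromorphic q -> generically (cond_q q) ->
  generically (fun t => PI_defect q t = f t) ->
  strongly_equivalent (sys_IXB2 q) (associated_system (PI f)).
Proof.
move=> mq cq qf; have [T [oT gT cfq cfq' TP]] := PI_parameter mq cq qf.
have toE : to_PI_IXB2 q = fun x =>
    (x.1.2 / 6 + q x.2, x.1.1 * x.1.2 / 6 + derive1 q x.2) by exact: fun3_ext.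
have fromE : from_PI_IXB2 q = fun x =>
    ((x.1.2 - derive1 q x.2) / (x.1.1 - q x.2), 6 * (x.1.1 - q x.2)).
  exact: fun3_ext.
apply: (@strongly_equivalent_intro R T (fun x => x.1.2) (fun x => x.1.1 - q x.2)
  (to_PI_IXB2 q) (from_PI_IXB2 q) _ _ oT gT).
- by split; regular_tac.
- move=> t Tt /=; split; [polyfun_tac|polyfun_tac| |].
  + by exists (0, 1); rewrite /= oner_neq0.
  + by exists (1 + q t, 0); rewrite /= addrK oner_neq0.
- move=> t Tt; rewrite toE fromE /=; split.
  + by apply: fraction_poly; polyfun_tac.
  + by apply: fraction_poly; polyfun_tac.
  + by exists (fun z => z.2 - derive1 q t); split; [polyfun_tac|].
  + by apply: fraction_poly; polyfun_tac.
- rewrite toE fromE /=; split; regular_tac.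
  by move=> x [].
- move=> [y z] t Tt z0; split; last exact: IXB2_fromK.
  by rewrite /= addrK mulf_neq0 ?invr_eq0 ?pnatr_eq0.
- move=> [u v] t Tt uq; split; last by apply: IXB2_toK; rewrite -subr_eq0.
  by rewrite /= mulf_neq0 ?pnatr_eq0.
- move=> D zeta Do WD sol t Dt; have [/TP[q2 qft] _] := WD t Dt.
  exact: (IXB2_to_PI q2 qft (sol t Dt)).
- move=> D zeta Do WD sol t Dt; have [/TP[q2 qft] uq] := WD t Dt.
  exact: (PI_to_IXB2 q2 qft uq (sol t Dt)).
Qed.

(** The denominator u - q is squared, as z is quadratic in w = (u' - q') / (u - q). *)
Lemma IXB5_equivalent q f : meromorphic q -> generically (cond_q q) ->
  generically (fun t => PI_defect q t = f t) ->
  strongly_equivalent (sys_IXB5 q) (associated_system (PI f)).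
Proof.
move=> mq cq qf; have [T [oT gT cfq cfq' TP]] := PI_parameter mq cq qf.
have toE : to_PI_IXB5 q = fun x =>
    (x.1.1 ^+ 2 - x.1.2 / 3 - 2 * q x.2,
     2 * x.1.1 * (- x.1.1 ^+ 2 + x.1.2 + 3 * q x.2)
     - (4 * x.1.1 * x.1.2 - 9 * derive1 q x.2) / 3 - 2 * derive1 q x.2).
  exact: fun3_ext.
have fromE : from_PI_IXB5 q = fun x =>
    (- (1 / 2) * ((x.1.2 - derive1 q x.2) / (x.1.1 - q x.2)),
     3 / 4 * ((x.1.2 - derive1 q x.2) / (x.1.1 - q x.2)) ^+ 2
     - 3 * x.1.1 - 6 * q x.2).
  exact: fun3_ext.
apply: (@strongly_equivalent_intro R T
  (fun x => x.1.1 ^+ 2 - x.1.2 / 3 - 2 * q x.2 - q x.2)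
  (fun x => (x.1.1 - q x.2) ^+ 2)
  (to_PI_IXB5 q) (from_PI_IXB5 q) _ _ oT gT).
- by split; regular_tac.
- move=> t Tt /=; split; [polyfun_tac|polyfun_tac| |].
  + exists (0, - (3 * (3 * q t + 1))) => /=.
    by rewrite [X in X != 0](_ : _ = 1); [exact: oner_neq0|field].
  + by exists (1 + q t, 0); rewrite /= addrK expr1n oner_neq0.
- move=> t Tt; rewrite toE fromE /=; split.
  + by apply: fraction_poly; polyfun_tac.
  + by apply: fraction_poly; polyfun_tac.
  + exists (fun z => - (1 / 2) * (z.2 - derive1 q t) * (z.1 - q t)).
    split; first by polyfun_tac.
    by move=> z; rewrite expf_eq0 /= => uq; field.
  + exists (fun z => 3 / 4 * (z.2 - derive1 q t) ^+ 2
                     - (3 * z.1 + 6 * q t) * (z.1 - q t) ^+ 2).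
    split; first by polyfun_tac.
    by move=> z; rewrite expf_eq0 /= => uq; field.
- rewrite toE fromE /=; split; regular_tac;
    by move=> x []; rewrite expf_eq0.
- move=> [y z] t Tt /= yz; split; last by apply: IXB5_fromK; rewrite -subr_eq0.
  by rewrite expf_neq0.
- move=> [u v] t Tt /=; rewrite expf_eq0 /= => uq.
  have uq' : u != q t by rewrite -subr_eq0.
  split; last exact: IXB5_toK.
  by rewrite [X in X != 0](_ : _ = u - q t); [exact: uq|field].
- move=> D zeta Do WD sol t Dt; have [/TP[q2 qft] _] := WD t Dt.
  exact: (IXB5_to_PI q2 qft (sol t Dt)).
- move=> D zeta Do WD sol t Dt; have [/TP[q2 qft]] := WD t Dt.
  rewrite expf_eq0 /= => uq.
  exact: (PI_to_IXB5 q2 qft uq (sol t Dt)).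
Qed.

(** The definition of q expresses p' through q, p and r. *)
Lemma derivable_XIV_derive1 r p t : derivable r t 1 -> derivable p t 1 ->
  derivable (q_XIV r p) t 1 -> derivable (derive1 p) t 1.
Proof.
move=> /is_derive_derive1 dr /is_derive_derive1 dp /is_derive_derive1 dq.
have pE : \forall s \near t, 12 * q_XIV r p s - p s ^+ 2 + r s = derive1 p s.
  by near=> s; rewrite (@q_XIVE _ (q_XIV r p) r p s).
have d12q := is_derive_mul (is_derive_const t 12) dq.
have dp2 := is_derive_opp (is_derive_exp 2 dp).
exact: is_derive_derivable
  (near_is_derive pE (is_derive_add (is_derive_add d12q dp2) dr)).
Unshelve. all: by end_near. Qed.

(** Off a closed discrete set both are polynomials in p, p', p'', r and r'. *)
Lemma meromorphic_q_XIV r p : meromorphic r -> meromorphic p ->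
  generically (cond_XIV r p) ->
  meromorphic_nvar (q_XIV r p : (C : normedModType C) -> C) /\
  meromorphic_nvar (derive1 (q_XIV r p) : (C : normedModType C) -> C).
Proof.
move=> mr mp cond.
have mC (c : C) : meromorphic_nvar ((fun=> c) : (C : normedModType C) -> C).
  by apply: meromorphic_differentiable => t; exact: differentiable_cst.
have [mrn mpn] := (meromorphic_pole mr, meromorphic_pole mp).
have mp' := meromorphic_derive1 mp; have mp'n := meromorphic_pole mp'.
have mrN : meromorphic_nvar ((fun t => -1 * r t) : (C : normedModType C) -> C).
  exact: meromorphic_mul (mC _) mrn.
split.
  have -> : q_XIV r p = fun t => (derive1 p t + p t * p t + -1 * r t) * 12^-1.
    by apply/funext => t; rewrite /q_XIV expr2 mulN1r.
  apply: meromorphic_mul (mC _); apply: meromorphic_add mrN.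
  by apply: meromorphic_add => //; exact: meromorphic_mul.
apply: (@meromorphic_generic_eq _ (fun t =>
  (derive1 (derive1 p) t + 2 * (p t * derive1 p t) + -1 * derive1 r t) * 12^-1)).
  apply: sub_generically cond => t [dr dp [[dq _] _]].
  have drt := is_derive_derivable dr.
  have /is_derive_derive1 ddp := derivable_XIV_derive1 drt dp dq.
  move: dp drt => /is_derive_derive1 dp /is_derive_derive1 drt.
  have dqt : is_derive t 1 (q_XIV r p) _ :=
    is_derive_mul (is_derive_add (is_derive_add ddp (is_derive_exp 2 dp))
      (is_derive_opp drt)) (is_derive_const t 12^-1).
  rewrite (is_derive_derive1E dqt) {dqt dr drt dp dq ddp} /=.
  by move: (derive1 (derive1 p) t : C) (derive1 p t : C) (derive1 r t : C);
    move=> p2 p1 r1; ring.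
apply: meromorphic_mul (mC _); apply: meromorphic_add.
  apply: meromorphic_add; first exact/meromorphic_pole/meromorphic_derive1.
  by apply: meromorphic_mul (mC _) _; exact: meromorphic_mul.
by apply: meromorphic_mul (mC _) _; exact/meromorphic_pole/meromorphic_derive1.
Qed.

(** Here u - q = (z y + r) / 6, and (u - q) (w - p) is the second factor of the
denominator on the side of u. *)
Lemma XIV_equivalent r p f : meromorphic r -> meromorphic p ->
  generically (cond_XIV r p) ->
  generically (fun t => PI_defect (q_XIV r p) t = f t) ->
  strongly_equivalent (sys_XIV r p) (associated_system (PI f)).
Proof.
move=> mr mp cond qf; have [mq mq'] := meromorphic_q_XIV mr mp cond.
pose good t := cond_XIV r p t /\ PI_defect (q_XIV r p) t = f t.
pose T : set C := good°.
have oT : open T by exact: open_interior.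
have gT : generically (fun t => T t).
  exact/generically_interior/generically_and.
have TP t : T t -> good t by exact: interior_subset.
have r_near t : T t -> \forall s \near t, is_derive (s : C) 1 r (p s * r s).
  by move=> Tt; apply: filterS Tt => s [[]].
have r'E t : T t -> derive1 r t = p t * r t.
  by move=> /TP[[/is_derive_derive1E]].
set q := q_XIV r p.
have cfq : coefficient T q.
  by split; [move=> t /TP[[_ _ [[dq _] _]] _]; exact: dq|exact: mq].
have cfq' : coefficient T (derive1 q).
  by split; [move=> t /TP[[_ _ [[_ dq'] _]] _]; exact: dq'|exact: mq'].
have cfp : coefficient T p.
  by split; [move=> t /TP[[_ dp _] _]; exact: dp|exact: meromorphic_pole].
have cfr : coefficient T r.
  split; last exact: meromorphic_pole.
  by move=> t /TP[[dr _ _] _]; exact: is_derive_derivable dr.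
have cfr' : coefficient T (derive1 r).
  split; last exact/meromorphic_pole/meromorphic_derive1.
  move=> t Tt; have [[dr /is_derive_derive1 dp _] _] := TP t Tt.
  have prE : \forall s \near t, p s * r s = derive1 r s.
    by apply: filterS (r_near t Tt) => s /is_derive_derive1E.
  exact: is_derive_derivable (near_is_derive prE (is_derive_mul dp dr)).
have toE : to_PI_XIV q r p = fun x =>
    (x.1.2 * x.1.1 / 6 + r x.2 / 6 + q x.2,
     ((x.1.2 * (x.1.1 - x.1.2) - 2 * p x.2 * x.1.2) * x.1.1
      + x.1.2 * (x.1.1 * (2 * x.1.2 - x.1.1) + 3 * p x.2 * x.1.1 + r x.2)) / 6
     + derive1 r x.2 / 6 + derive1 q x.2).
  exact: fun3_ext.
have fromE : from_PI_XIV q r p = fun x =>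
    ((6 * x.1.1 - 6 * q x.2 - r x.2) /
       ((x.1.2 - derive1 q x.2) / (x.1.1 - q x.2) - p x.2),
     (x.1.2 - derive1 q x.2) / (x.1.1 - q x.2) - p x.2).
  exact: fun3_ext.
have denom u v t :
    (u - q t) * (v - derive1 q t - p t * (u - q t)) != 0 ->
    u - q t != 0 /\ (v - derive1 q t) / (u - q t) - p t != 0.
  rewrite mulf_eq0 negb_or => /andP[uq vq]; split=> //.
  apply: contra_neq vq => w; have : (v - derive1 q t) / (u - q t) = p t.
    by apply/eqP; rewrite -subr_eq0 w.
  by move=> <-; rewrite divfK // subrr.
apply: (@strongly_equivalent_intro R T
  (fun x => x.1.2 * (x.1.2 * x.1.1 + r x.2))
  (fun x => (x.1.1 - q x.2) *
            (x.1.2 - derive1 q x.2 - p x.2 * (x.1.1 - q x.2)))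
  (to_PI_XIV q r p) (from_PI_XIV q r p) _ _ oT gT).
- by split; regular_tac.
- move=> t Tt /=; split; [polyfun_tac|polyfun_tac| |].
  + by exists (1 - r t, 1); rewrite /= !mul1r subrK oner_neq0.
  + exists (1 + q t, derive1 q t + p t + 1) => /=.
    by rewrite [X in X != 0](_ : _ = 1); [exact: oner_neq0|ring].
- move=> t Tt; rewrite toE fromE /=; split.
  + by apply: fraction_poly; polyfun_tac.
  + by apply: fraction_poly; polyfun_tac.
  + exists (fun z => (6 * z.1 - 6 * q t - r t) * (z.1 - q t) ^+ 2).
    split; first by polyfun_tac.
    move=> z; rewrite mulf_eq0 negb_or => /andP[uq vq].
    by field; rewrite uq ?mulNr vq.
  + exists (fun z => (z.2 - derive1 q t - p t * (z.1 - q t)) ^+ 2).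
    split; first by polyfun_tac.
    move=> z; rewrite mulf_eq0 negb_or => /andP[uq vq].
    by field; rewrite uq ?mulNr vq.
- rewrite toE fromE /=; split; regular_tac => -[[u v] t] [_ /denom[]] //.
- move=> [y z] t Tt; rewrite [X in X -> _]/= mulf_eq0 negb_or => /andP[z0 zyr].
  have zyr' : z * y / 6 + r t / 6 + q t != q t.
    by rewrite -subr_eq0 addrK -mulrDl mulf_neq0 ?invr_eq0 ?pnatr_eq0.
  split; last exact: XIV_fromK (r'E t Tt) zyr' z0.
  rewrite /= (r'E t Tt) [X in X != 0](_ : _ =
    ((z * y + r t) / 6) ^+ 2 * z); last by rewrite /=; field.
  by rewrite mulf_neq0 // expf_neq0 // mulf_neq0 ?invr_eq0 ?pnatr_eq0.
- move=> [u v] t Tt /denom[uq wp].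
  split; last by apply: XIV_toK (r'E t Tt) _ _; rewrite -subr_eq0.
  rewrite /= [X in _ * (X + _)]mulrC divfK // mulf_neq0 //.
  rewrite [X in X != 0](_ : _ = 6 * (u - q t)); last ring.
  by rewrite mulf_neq0 ?pnatr_eq0.
- move=> D zeta Do WD sol t Dt; have [Tt _] := WD t Dt.
  have [[_ dp [dq _]] qft] := TP t Tt.
  exact: (XIV_to_PI (r_near t Tt) dp erefl dq qft (sol t Dt)).
- move=> D zeta Do WD sol t Dt; have [Tt /denom[uq wp]] := WD t Dt.
  have [[dr dp [dq _]] qft] := TP t Tt.
  exact: (PI_to_XIV dr dp erefl dq qft uq wp (sol t Dt)).
Qed.

Lemma IXB3_equivalent f (a0 alpha : C) : (forall t, derivable f t 1) ->
  (forall t, alpha = a0 - derive1 f t / 2) ->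
  strongly_equivalent (sys_IXB3 f a0) (associated_system (PII f alpha)).
Proof.
move=> df alphaE; have cff := coefficient_entire df.
have toE : to_PII_IXB3 f a0 = fun x =>
    (x.1.1, - x.1.1 ^+ 2 + x.1.2 - f x.2 / 2) by exact: fun3_ext.
have fromE : from_PII_IXB3 f = fun x =>
    (x.1.1, x.1.2 + x.1.1 ^+ 2 + f x.2 / 2) by exact: fun3_ext.
apply: (@strongly_equivalent_intro R setT (fun=> 1) (fun=> 1)
  (to_PII_IXB3 f a0) (from_PII_IXB3 f)).
- exact: openT.
- exact: generically_everywhere.
- by split; regular_tac.
- by move=> t _ /=; split; [polyfun_tac|polyfun_tac| |];
    exists (0, 0); exact: oner_neq0.
- by move=> t _; rewrite toE fromE /=; split; apply: fraction_poly; polyfun_tac.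
- by rewrite toE fromE /=; split; regular_tac.
- by move=> [y z] t _ _; split; [exact: oner_neq0|exact: IXB3_fromK].
- by move=> [u v] t _ _; split; [exact: oner_neq0|exact: IXB3_toK].
- move=> D zeta Do WD sol t Dt.
  exact: (IXB3_to_PII (df t) (alphaE t) (sol t Dt)).
- move=> D zeta Do WD sol t Dt.
  exact: (PII_to_IXB3 (df t) (alphaE t) (sol t Dt)).
Qed.

Lemma XIII_equivalent f p (alpha : C) : (forall t, derivable f t 1) ->
  meromorphic p -> generically (cond_XIII f p) ->
  generically (fun t => alpha = - PII_defect f p t) ->
  strongly_equivalent (sys_XIII f p) (associated_system (PII f alpha)).
Proof.
move=> df mp cond alphaE.
pose T : set C := [set t | cond_XIII f p t /\ alpha = - PII_defect f p t]°.
have oT : open T by exact: open_interior.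
have gT : generically (fun t => T t).
  exact/generically_interior/generically_and.
have TP t : T t -> twice_derivable p t /\ alpha = - PII_defect f p t.
  by move=> /interior_subset[[]].
have cff : coefficient T f.
  by split; [move=> t _; exact: df|exact: (coefficient_entire df).2].
have cfp : coefficient T p.
  by split; [move=> t /TP[[dp _] _]; exact: dp|exact: meromorphic_pole].
have cfp' : coefficient T (derive1 p).
  split; first by move=> t /TP[[_ dp'] _]; exact: dp'.
  exact/meromorphic_pole/meromorphic_derive1.
have toE : to_PII_XIII f p = fun x =>
    (x.1.1 / 2 - p x.2,
     (x.1.1 * (2 * x.1.2 - x.1.1) / 2 + 2 * p x.2 * x.1.1) / 2 - derive1 p x.2).
  exact: fun3_ext.
have fromE : from_PII_XIII p = fun x =>
    (2 * (x.1.1 + p x.2),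
     x.1.1 - p x.2 + (x.1.2 + derive1 p x.2) / (x.1.1 + p x.2)).
  exact: fun3_ext.
apply: (@strongly_equivalent_intro R T (fun x => x.1.1) (fun x => x.1.1 + p x.2)
  (to_PII_XIII f p) (from_PII_XIII p) _ _ oT gT).
- by split; regular_tac.
- move=> t Tt /=; split; [polyfun_tac|polyfun_tac| |].
  + by exists (1, 0); rewrite /= oner_neq0.
  + by exists (1 - p t, 0); rewrite /= subrK oner_neq0.
- move=> t Tt; rewrite toE fromE /=; split.
  + by apply: fraction_poly; polyfun_tac.
  + by apply: fraction_poly; polyfun_tac.
  + by apply: fraction_poly; polyfun_tac.
  + exists (fun z => (z.1 - p t) * (z.1 + p t) + (z.2 + derive1 p t)).
    split; first by polyfun_tac.
    by move=> z up; field.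
- rewrite toE fromE /=; split; regular_tac.
  by move=> x [].
- move=> [y z] t Tt y0; split; last exact: XIII_fromK.
  by rewrite /= subrK mulf_neq0 ?invr_eq0 ?pnatr_eq0.
- move=> [u v] t Tt up; split; last exact: XIII_toK.
  by rewrite /= mulf_neq0 ?pnatr_eq0.
- move=> D zeta Do WD sol t Dt; have [/TP[p2 pf] _] := WD t Dt.
  exact: (XIII_to_PII p2 pf (sol t Dt)).
- move=> D zeta Do WD sol t Dt; have [/TP[p2 pf] up] := WD t Dt.
  exact: (PII_to_XIII p2 pf up (sol t Dt)).
Qed.

Lemma XII_equivalent f (a0 b0 alpha beta : C) : (forall t, derivable f t 1) ->
  (forall t, alpha = a0 / 2 + b0 - derive1 f t) -> beta = - (a0 ^+ 2 / 2) ->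
  strongly_equivalent (sys_XII f a0 b0) (associated_system (PIV f alpha beta)).
Proof.
move=> df alphaE betaE; have cff := coefficient_entire df.
have toE : to_PIV_XII f a0 b0 = fun x =>
    (x.1.2, x.1.2 * (x.1.2 - 2 * x.1.1) + 2 * f x.2 * x.1.2 - a0).
  exact: fun3_ext.
have fromE : from_PIV_XII f a0 = fun x =>
    (- (x.1.2 / (2 * x.1.1)) + x.1.1 / 2 + f x.2 - a0 / (2 * x.1.1), x.1.1).
  exact: fun3_ext.
apply: (@strongly_equivalent_intro R setT (fun x => x.1.2) (fun x => x.1.1)
  (to_PIV_XII f a0 b0) (from_PIV_XII f a0)).
- exact: openT.
- exact: generically_everywhere.
- by split; regular_tac.
- move=> t _ /=; split; [polyfun_tac|polyfun_tac| |].
  + by exists (0, 1); exact: oner_neq0.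
  + by exists (1, 0); exact: oner_neq0.
- move=> t _; rewrite toE fromE /=; split.
  + by apply: fraction_poly; polyfun_tac.
  + by apply: fraction_poly; polyfun_tac.
  + exists (fun z => - (z.2 / 2) + z.1 ^+ 2 / 2 + f t * z.1 - a0 / 2).
    split; first by polyfun_tac.
    by move=> z u0; field.
  + by apply: fraction_poly; polyfun_tac.
- rewrite toE fromE /=; split; regular_tac => x [_ u0];
    by rewrite mulf_neq0 ?pnatr_eq0.
- by move=> [y z] t _ z0; split; [exact: z0|exact: XII_fromK].
- by move=> [u v] t _ u0; split; [exact: u0|exact: XII_toK].
- move=> D zeta Do WD sol t Dt; have [_ z0] := WD t Dt.
  exact: (XII_to_PIV (df t) (alphaE t) betaE z0 (sol t Dt)).
- move=> D zeta Do WD sol t Dt; have [_ u0] := WD t Dt.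
  exact: (PIV_to_XII (df t) (alphaE t) betaE u0 (sol t Dt)).
Qed.

Lemma sys_V_PI f : sys_V f = associated_system (PI f).
Proof. by apply/funext => -[y z]. Qed.

Lemma PI_class_equivalent f S : PI_class f S ->
  strongly_equivalent S (associated_system (PI f)).
Proof.
case=> [|q mq cq qf|q mq cq qf|r p mr mp cond qf].
- by rewrite sys_V_PI; exact: strongly_equivalent_refl.
- exact: IXB2_equivalent.
- exact: IXB5_equivalent.
- exact: XIV_equivalent.
Qed.

End Instances.

(** * Solutions on a domain *)

Section Solutions.
Variable R : realType.
Local Notation C := (cplx R).
Local Notation C2 := (C * C)%type.
Local Notation C3 := (C * C * C)%type.
Implicit Types (t : C) (f g q r p u : C -> C) (D : set C) (zeta w : C -> C2).

Lemma near_derive1 f g t : (\forall s \near t, f s = g s) ->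
  \forall s \near t, derive1 f s = derive1 g s.
Proof.
move=> /nbhs_interior; apply: filterS => s fg.
by rewrite !derive1E; exact: near_eq_derive.
Qed.

Lemma near_derivable f g t : (\forall s \near t, f s = g s) ->
  derivable f t 1 -> derivable g t 1.
Proof.
by move=> fg /is_derive_derive1 df; exact: is_derive_derivable (near_is_derive fg df).
Qed.

Lemma near_second_derivative_zero f g t : (\forall s \near t, f s = g s) ->
  second_derivative_zero f t -> second_derivative_zero g t.
Proof.
move=> fg [df ddf]; split; first exact: near_derivable fg df.
exact: near_is_derive (near_derive1 fg) ddf.
Qed.

Lemma near_cond_q f g t : (\forall s \near t, f s = g s) ->
  cond_q f t -> cond_q g t.
Proof.
move=> fg [[df ddf] sf]; have fg' := near_derive1 fg.
have fg'' := near_derive1 fg'.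
split; first by split; [exact: near_derivable fg df|exact: near_derivable fg' ddf].
have defectE : \forall s \near t, PI_defect f s = PI_defect g s.
  apply: (@filterS _ (nbhs t) _ _ _ _ (filterI fg'' fg)) => s [f''E fE].
  have eq_defect (a b c d : C) : a = b -> c = d -> a - 6 * c ^+ 2 = b - 6 * d ^+ 2.
    by move=> -> ->.
  exact: eq_defect f''E fE.
exact: near_second_derivative_zero defectE sf.
Qed.

Lemma near_open D (P : C -> Prop) t : open D -> D t ->
  (forall s, D s -> P s) -> \forall s \near t, P s.
Proof.
move=> Do Dt DP; have := open_nbhs_nbhs (conj Do Dt).
by apply: filterS => s; exact: DP.
Qed.

(** The second equation is only required on D', since the right-hand side of the
fourth Painleve equation makes sense only for u <> 0. *)
Lemma solves2_of D D' (rhs : equation2 R) w : open D -> D' `<=` D ->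
  (forall t, D t -> is_derive t 1 (fun s => (w s).1) (w t).2) ->
  (forall t, D' t -> is_derive t 1 (fun s => (w s).2) (rhs (w t).1 (w t).2 t)) ->
  (forall t, D t -> w t = ((w t).1, derive1 (fun s => (w s).1) t)) /\
  solves2 rhs D' (fun t => (w t).1).
Proof.
move=> Do D'D dw1 dw2.
have w2 t : D t -> (w t).2 = derive1 (fun s => (w s).1) t.
  by move=> Dt; rewrite (is_derive_derive1E (dw1 t Dt)).
split=> [t Dt|t D't]; first by rewrite -w2 // -surjective_pairing.
have Dt := D'D t D't; rewrite /associated_system /=; split.
  by rewrite -w2 //; exact: dw1.
rewrite -w2 //; apply: near_is_derive (dw2 t D't).
exact: near_open Do Dt w2.
Qed.

Lemma solves_PI D f u : solves2 (PI f) D u -> forall t, D t ->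
  twice_derivable u t /\ PI_defect u t = f t.
Proof.
move=> sol t /sol[/= du ddu]; split.
  by split; [exact: is_derive_derivable du|exact: is_derive_derivable ddu].
by rewrite /PI_defect (is_derive_derive1E ddu) /PI addrC addKr.
Qed.

Lemma sol_PI_cond D f q t : open D -> sol_PI f D q -> D t -> cond_q q t.
Proof.
move=> Do [sf sq] Dt; have qD := solves_PI sq; split; first by have [] := qD t Dt.
apply: near_second_derivative_zero (sf t Dt).
by apply: near_open Do Dt _ => s /qD[].
Qed.

Lemma derive1_constant f : (forall t, second_derivative_zero f t) ->
  forall t, derive1 f t = derive1 f 0.
Proof. by move=> sf t; apply: zero_derive_segment => s _; exact: (sf _).2. Qed.

Lemma domain_derive1_constant f D : domain D ->
  (forall t, D t -> second_derivative_zero f t) ->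
  exists c, forall t, D t -> derive1 f t = c.
Proof. by move=> Dd sf; apply: domain_zero_derive => // t /sf[]. Qed.

Lemma sol_IXB2_to_PI D q zeta : open D -> sol_IXB2 q D zeta ->
  let u := fun t => (zeta t).2 / 6 + q t in
  sol_PI (PI_defect q) D u /\
  forall t, D t -> to_PI_IXB2 q (zeta t, t) = (u t, derive1 u t).
Proof.
move=> Do [cq sol] u.
have sol' t (Dt : D t) := IXB2_to_PI (cq t Dt).1 erefl (sol t Dt).
have uE : (fun t => (to_PI_IXB2 q (zeta t, t)).1) = u.
  by apply/funext => t; rewrite /u /to_PI_IXB2; case: (zeta t).
have [] := @solves2_of D D (PI (PI_defect q)) (fun t => to_PI_IXB2 q (zeta t, t)) Do.
- by [].
- by move=> t /sol'[].
- by move=> t /sol'[].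
rewrite uE => toE sol2; split; first by split=> // t /cq[].
by move=> t Dt; rewrite toE //; congr (_, _); rewrite -uE.
Qed.

Lemma sol_PI_to_IXB2 D f q u : open D -> sol_PI f D u -> sol_PI f D q ->
  sol_IXB2 q (D `&` [set t | u t != q t])
    (fun t => from_PI_IXB2 q (u t, derive1 u t, t)).
Proof.
move=> Do [sf su] sq; split=> [t [Dt _]|t [Dt /= uq]]; first exact: sol_PI_cond sq Dt.
have [q2 qf] := solves_PI sq.2 Dt.
by apply: (PI_to_IXB2 q2 qf _ (su t Dt)); rewrite subr_eq0.
Qed.

Lemma sol_IXB5_to_PI D q zeta : open D -> sol_IXB5 q D zeta ->
  let u := fun t => (zeta t).1 ^+ 2 - (zeta t).2 / 3 - 2 * q t in
  sol_PI (PI_defect q) D u /\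
  forall t, D t -> to_PI_IXB5 q (zeta t, t) = (u t, derive1 u t).
Proof.
move=> Do [cq sol] u.
have sol' t (Dt : D t) := IXB5_to_PI (cq t Dt).1 erefl (sol t Dt).
have uE : (fun t => (to_PI_IXB5 q (zeta t, t)).1) = u.
  by apply/funext => t; rewrite /u /to_PI_IXB5; case: (zeta t).
have [] := @solves2_of D D (PI (PI_defect q)) (fun t => to_PI_IXB5 q (zeta t, t)) Do.
- by [].
- by move=> t /sol'[].
- by move=> t /sol'[].
rewrite uE => toE sol2; split; first by split=> // t /cq[].
by move=> t Dt; rewrite toE //; congr (_, _); rewrite -uE.
Qed.

Lemma sol_PI_to_IXB5 D f q u : open D -> sol_PI f D u -> sol_PI f D q ->
  sol_IXB5 q (D `&` [set t | u t != q t])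
    (fun t => from_PI_IXB5 q (u t, derive1 u t, t)).
Proof.
move=> Do [sf su] sq; split=> [t [Dt _]|t [Dt /= uq]]; first exact: sol_PI_cond sq Dt.
have [q2 qf] := solves_PI sq.2 Dt.
by apply: (PI_to_IXB5 q2 qf _ (su t Dt)); rewrite subr_eq0.
Qed.

Lemma sol_XIV_to_PI D r p zeta : open D -> sol_XIV r p D zeta ->
  let q := q_XIV r p in
  let u := fun t => (zeta t).2 * (zeta t).1 / 6 + r t / 6 + q t in
  sol_PI (PI_defect q) D u /\
  forall t, D t -> to_PI_XIV q r p (zeta t, t) = (u t, derive1 u t).
Proof.
move=> Do [cond sol] q u.
have r_near t : D t -> \forall s \near t, is_derive (s : C) 1 r (p s * r s).
  by move=> Dt; apply: near_open Do Dt _ => s /cond[].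
have cq t : D t -> cond_q q t by move=> /cond[].
have dp t : D t -> derivable p t 1 by move=> /cond[].
have sol' t (Dt : D t) :=
  XIV_to_PI (r_near t Dt) (dp t Dt) erefl (cq t Dt).1 erefl (sol t Dt).
have uE : (fun t => (to_PI_XIV q r p (zeta t, t)).1) = u.
  by apply/funext => t; rewrite /u /to_PI_XIV; case: (zeta t).
have [] := @solves2_of D D (PI (PI_defect q)) (fun t => to_PI_XIV q r p (zeta t, t)) Do.
- by [].
- by move=> t /sol'[].
- by move=> t /sol'[].
rewrite uE => toE sol2; split; first by split=> // t /cq[].
by move=> t Dt; rewrite toE //; congr (_, _); rewrite -uE.
Qed.

Lemma sol_PI_to_XIV D f q r p u : open D -> sol_PI f D u -> sol_PI f D q ->
  (forall t, D t -> is_derive t 1 r (p t * r t)) ->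
  (forall t, D t -> derivable p t 1) ->
  (forall t, D t -> q t = q_XIV r p t) ->
  sol_XIV r p
    (D `&` [set t | u t != q t /\
                    (derive1 u t - derive1 q t) / (u t - q t) != p t])
    (fun t => from_PI_XIV q r p (u t, derive1 u t, t)).
Proof.
move=> Do [sf su] sq dr dp qE; split=> [t [Dt _]|t [Dt [/= uq wp]]].
  split; [exact: dr|exact: dp|].
  exact: near_cond_q (near_open Do Dt qE) (sol_PI_cond Do sq Dt).
have [q2 qf] := solves_PI sq.2 Dt.
by apply: (PI_to_XIV (dr t Dt) (dp t Dt) (qE t Dt) q2 qf _ _ (su t Dt));
  rewrite subr_eq0.
Qed.

Lemma sol_IXB3_to_PII D f (a0 : C) zeta : domain D -> sol_IXB3 f a0 D zeta ->
  let u := fun t => (zeta t).1 in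
  exists alpha : C,
    [/\ forall t, D t -> alpha = a0 - derive1 f t / 2,
        sol_PII f alpha D u &
        forall t, D t -> to_PII_IXB3 f a0 (zeta t, t) = (u t, derive1 u t)].
Proof.
move=> Dd [sf sol] u; have [c cP] := domain_derive1_constant Dd sf.
exists (a0 - c / 2).
have alphaE t : D t -> a0 - c / 2 = a0 - derive1 f t / 2 by move=> /cP ->.
have sol' t (Dt : D t) := IXB3_to_PII (sf t Dt).1 (alphaE t Dt) (sol t Dt).
have uE : (fun t => (to_PII_IXB3 f a0 (zeta t, t)).1) = u.
  by apply/funext => t; rewrite /u /to_PII_IXB3; case: (zeta t).
have [] := @solves2_of D D (PII f (a0 - c / 2))
  (fun t => to_PII_IXB3 f a0 (zeta t, t)) Dd.1.
- by [].
- by move=> t /sol'[].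
- by move=> t /sol'[].
rewrite uE => toE sol2; split; [exact: alphaE|by split|].
by move=> t Dt; rewrite toE //; congr (_, _); rewrite -uE.
Qed.

Lemma sol_PII_to_IXB3 D f (alpha : C) u : domain D -> sol_PII f alpha D u ->
  exists a0 : C,
    (forall t, D t -> a0 = alpha + derive1 f t / 2) /\
    sol_IXB3 f a0 D (fun t => from_PII_IXB3 f (u t, derive1 u t, t)).
Proof.
move=> Dd [sf su]; have [c cP] := domain_derive1_constant Dd sf.
exists (alpha + c / 2); split; first by move=> t /cP ->.
split; [exact: sf|move=> t Dt].
apply: PII_to_IXB3 (sf t Dt).1 _ (su t Dt).
by rewrite (cP t Dt) addrK.
Qed.

Lemma sol_XIII_to_PII D f p zeta : domain D -> sol_XIII f p D zeta ->
  let u := fun t => (zeta t).1 / 2 - p t in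
  exists alpha : C,
    [/\ forall t, D t -> alpha = - PII_defect f p t,
        sol_PII f alpha D u &
        forall t, D t -> to_PII_XIII f p (zeta t, t) = (u t, derive1 u t)].
Proof.
move=> Dd [cond sol] u.
have [c cP] : exists c, forall t, D t -> PII_defect f p t = c.
  by apply: domain_zero_derive => // t /cond[].
have alphaE t : D t -> - c = - PII_defect f p t by move=> /cP ->.
have p2 t : D t -> twice_derivable p t by move=> /cond[].
have sol' t (Dt : D t) := XIII_to_PII (p2 t Dt) (alphaE t Dt) (sol t Dt).
have uE : (fun t => (to_PII_XIII f p (zeta t, t)).1) = u.
  by apply/funext => t; rewrite /u /to_PII_XIII; case: (zeta t).
exists (- c).
have [] := @solves2_of D D (PII f (- c))
  (fun t => to_PII_XIII f p (zeta t, t)) Dd.1.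
- by [].
- by move=> t /sol'[].
- by move=> t /sol'[].
rewrite uE => toE sol2; split; [exact: alphaE|by split=> // t /cond[]|].
by move=> t Dt; rewrite toE //; congr (_, _); rewrite -uE.
Qed.

Lemma sol_PII_to_XIII D f (alpha : C) u p : open D -> sol_PII f alpha D u ->
  (forall t, D t -> twice_derivable p t) ->
  (forall t, D t -> alpha = - PII_defect f p t) ->
  sol_XIII f p (D `&` [set t | u t + p t != 0])
    (fun t => from_PII_XIII p (u t, derive1 u t, t)).
Proof.
move=> Do [sf su] p2 alphaE; split=> [t [Dt _]|t [Dt /= up]]; last first.
  exact: (@PII_to_XIII _ f p alpha (fun s => (u s, derive1 u s)) t
    (p2 t Dt) (alphaE t Dt) up (su t Dt)).
split; [exact: sf|exact: p2|].
apply: local_constant_derive.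
have defectE s : D s -> PII_defect f p s = PII_defect f p t.
  by move=> Ds; apply: oppr_inj; rewrite -!alphaE.
exact: near_open Do Dt defectE.
Qed.

Lemma sol_XII_to_PIV D f (a0 b0 : C) zeta : domain D -> sol_XII f a0 b0 D zeta ->
  let u := fun t => (zeta t).2 in
  exists alpha beta : C,
    [/\ forall t, D t -> alpha = a0 / 2 + b0 - derive1 f t,
        beta = - (a0 ^+ 2 / 2),
        sol_PIV f alpha beta (D `&` [set t | u t != 0]) u &
        forall t, D t -> to_PIV_XII f a0 b0 (zeta t, t) = (u t, derive1 u t)].
Proof.
move=> Dd [sf sol] u; have [c cP] := domain_derive1_constant Dd sf.
exists (a0 / 2 + b0 - c), (- (a0 ^+ 2 / 2)).
have alphaE t : D t -> a0 / 2 + b0 - c = a0 / 2 + b0 - derive1 f t.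
  by move=> /cP ->.
have uE : (fun t => (to_PIV_XII f a0 b0 (zeta t, t)).1) = u.
  by apply/funext => t; rewrite /u /to_PIV_XII; case: (zeta t).
have [] := @solves2_of D (D `&` [set t | u t != 0])
  (PIV f (a0 / 2 + b0 - c) (- (a0 ^+ 2 / 2)))
  (fun t => to_PIV_XII f a0 b0 (zeta t, t)) Dd.1.
- by move=> t [].
- move=> t Dt; rewrite uE; have [_] := sol t Dt.
  by rewrite /to_PIV_XII; case: (zeta t).
- move=> t [Dt u0].
  by have [_] := XII_to_PIV (sf t Dt).1 (alphaE t Dt) erefl u0 (sol t Dt).
rewrite uE => toE sol2; split; [exact: alphaE|by []| |].
  by split=> // [t [Dt _]|t []//]; exact: sf.
by move=> t Dt; rewrite toE //; congr (_, _); rewrite -uE.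
Qed.

Lemma sol_PIV_to_XII D f (alpha beta : C) u (a0 b0 : C) :
  sol_PIV f alpha beta D u ->
  (forall t, D t -> alpha = a0 / 2 + b0 - derive1 f t) ->
  beta = - (a0 ^+ 2 / 2) ->
  sol_XII f a0 b0 D (fun t => from_PIV_XII f a0 (u t, derive1 u t, t)).
Proof.
move=> [sf u0 su] alphaE betaE; split; [exact: sf|move=> t Dt].
exact: (@PIV_to_XII _ f a0 b0 alpha beta (fun s => (u s, derive1 u s)) t
  (sf t Dt).1 (alphaE t Dt) betaE (u0 t Dt) (su t Dt)).
Qed.

End Solutions.

(** * The birational classes *)

Theorem proposition2 (R : realType) :
  (* Birational equivalence with the first-order systems of the Painleve
     equations: Painleve I's class. *)
  [/\ (forall f : cplx R -> cplx R,
         (forall t, second_derivative_zero f t) ->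
         birationally_equivalent (sys_V f) (associated_system (PI f))),
      (forall q : cplx R -> cplx R, meromorphic q -> generically (cond_q q) ->
         exists f : cplx R -> cplx R,
           [/\ forall t, second_derivative_zero f t,
               generically (fun t => PI_defect q t = f t),
               birationally_equivalent
                 (sys_IXB2 q) (associated_system (PI f)) &
               birationally_equivalent
                 (sys_IXB5 q) (associated_system (PI f))]),
      (forall r p : cplx R -> cplx R, meromorphic r -> meromorphic p ->
         generically (cond_XIV r p) ->
         exists f : cplx R -> cplx R,
           [/\ forall t, second_derivative_zero f t,
               generically (fun t => PI_defect (q_XIV r p) t = f t) &
               birationally_equivalent
                 (sys_XIV r p) (associated_system (PI f))]) &
      (forall (f : cplx R -> cplx R) (S S' : system R),
         (forall t, second_derivative_zero f t) ->
         PI_class f S -> PI_class f S' -> birationally_equivalent S S')]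
  /\
  (* Painleve II's and IV's classes. *)
  [/\ (forall (f : cplx R -> cplx R) (a0 : cplx R),
         (forall t, second_derivative_zero f t) ->
         exists alpha : cplx R,
           (forall t, alpha = a0 - derive1 f t / 2) /\
           birationally_equivalent
             (sys_IXB3 f a0) (associated_system (PII f alpha))),
      (forall f p : cplx R -> cplx R,
         (forall t, second_derivative_zero f t) -> meromorphic p ->
         generically (cond_XIII f p) ->
         exists alpha : cplx R,
           generically (fun t => alpha = - PII_defect f p t) /\
           birationally_equivalent
             (sys_XIII f p) (associated_system (PII f alpha))) &
      (forall (f : cplx R -> cplx R) (a0 b0 : cplx R),
         (forall t, second_derivative_zero f t) ->
         exists alpha beta : cplx R,
           [/\ forall t, alpha = a0 / 2 + b0 - derive1 f t,
               beta = - (a0 ^+ 2 / 2) &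
               birationally_equivalent
                 (sys_XII f a0 b0) (associated_system (PIV f alpha beta))])]
  /\
  (* System V. *)
  (forall f : cplx R -> cplx R, sys_V f = associated_system (PI f))
  /\
  forall D : set (cplx R), domain D ->
  (* System IX.B(2). *)
  [/\ (forall (q : cplx R -> cplx R) (zeta : cplx R -> cplx R * cplx R),
         sol_IXB2 q D zeta ->
         let u := fun t => (zeta t).2 / 6 + q t in
         sol_PI (PI_defect q) D u /\
         forall t, D t -> to_PI_IXB2 q (zeta t, t) = (u t, derive1 u t)),
      (forall f q u : cplx R -> cplx R, sol_PI f D u -> sol_PI f D q ->
         sol_IXB2 q (D `&` [set t | u t != q t])
           (fun t => from_PI_IXB2 q (u t, derive1 u t, t))) &
      (forall q : cplx R -> cplx R, (forall t, D t -> cond_q q t) ->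
       forall t, D t ->
         (forall y z : cplx R, z != 0 ->
            from_PI_IXB2 q (to_PI_IXB2 q (y, z, t), t) = (y, z)) /\
         (forall u v : cplx R, u != q t ->
            to_PI_IXB2 q (from_PI_IXB2 q (u, v, t), t) = (u, v)))]
  /\
  (* System IX.B(5). *)
  [/\ (forall (q : cplx R -> cplx R) (zeta : cplx R -> cplx R * cplx R),
         sol_IXB5 q D zeta ->
         let u := fun t => (zeta t).1 ^+ 2 - (zeta t).2 / 3 - 2 * q t in
         sol_PI (PI_defect q) D u /\
         forall t, D t -> to_PI_IXB5 q (zeta t, t) = (u t, derive1 u t)),
      (forall f q u : cplx R -> cplx R, sol_PI f D u -> sol_PI f D q ->
         sol_IXB5 q (D `&` [set t | u t != q t])
           (fun t => from_PI_IXB5 q (u t, derive1 u t, t))) &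
      (forall q : cplx R -> cplx R, (forall t, D t -> cond_q q t) ->
       forall t, D t ->
         (forall y z : cplx R, y ^+ 2 - z / 3 - 2 * q t != q t ->
            from_PI_IXB5 q (to_PI_IXB5 q (y, z, t), t) = (y, z)) /\
         (forall u v : cplx R, u != q t ->
            to_PI_IXB5 q (from_PI_IXB5 q (u, v, t), t) = (u, v)))]
  /\
  (* System XIV. *)
  [/\ (forall (r p : cplx R -> cplx R) (zeta : cplx R -> cplx R * cplx R),
         sol_XIV r p D zeta ->
         let q := q_XIV r p in
         let u := fun t => (zeta t).2 * (zeta t).1 / 6 + r t / 6 + q t in
         sol_PI (PI_defect q) D u /\
         forall t, D t -> to_PI_XIV q r p (zeta t, t) = (u t, derive1 u t)),
      (forall f q r p u : cplx R -> cplx R, sol_PI f D u -> sol_PI f D q ->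
         (forall t, D t -> is_derive t 1 r (p t * r t)) ->
         (forall t, D t -> derivable p t 1) ->
         (forall t, D t -> q t = q_XIV r p t) ->
         sol_XIV r p
           (D `&` [set t | u t != q t /\
                           (derive1 u t - derive1 q t) / (u t - q t) != p t])
           (fun t => from_PI_XIV q r p (u t, derive1 u t, t))) &
      (forall q r p : cplx R -> cplx R, (forall t, D t -> cond_XIV r p t) ->
         (forall t, D t -> q t = q_XIV r p t) ->
       forall t, D t ->
         (forall y z : cplx R,
            z * y / 6 + r t / 6 + q t != q t -> z != 0 ->
            from_PI_XIV q r p (to_PI_XIV q r p (y, z, t), t) = (y, z)) /\
         (forall u v : cplx R, u != q t ->
            (v - derive1 q t) / (u - q t) != p t ->
            to_PI_XIV q r p (from_PI_XIV q r p (u, v, t), t) = (u, v)))]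
  /\
  (* System IX.B(3). *)
  [/\ (forall (f : cplx R -> cplx R) (a0 : cplx R)
              (zeta : cplx R -> cplx R * cplx R),
         sol_IXB3 f a0 D zeta ->
         let u := fun t => (zeta t).1 in
         exists alpha : cplx R,
           [/\ forall t, D t -> alpha = a0 - derive1 f t / 2,
               sol_PII f alpha D u &
               forall t, D t -> to_PII_IXB3 f a0 (zeta t, t) = (u t, derive1 u t)]),
      (forall (f : cplx R -> cplx R) (alpha : cplx R) (u : cplx R -> cplx R),
         sol_PII f alpha D u ->
         exists a0 : cplx R,
           (forall t, D t -> a0 = alpha + derive1 f t / 2) /\
           sol_IXB3 f a0 D (fun t => from_PII_IXB3 f (u t, derive1 u t, t))) &
      (forall (f : cplx R -> cplx R) (a0 : cplx R),
         (forall t, D t -> second_derivative_zero f t) ->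
       forall t, D t ->
         (forall y z : cplx R,
            from_PII_IXB3 f (to_PII_IXB3 f a0 (y, z, t), t) = (y, z)) /\
         (forall u v : cplx R,
            to_PII_IXB3 f a0 (from_PII_IXB3 f (u, v, t), t) = (u, v)))]
  /\
  (* System XIII. *)
  [/\ (forall (f p : cplx R -> cplx R) (zeta : cplx R -> cplx R * cplx R),
         sol_XIII f p D zeta ->
         let u := fun t => (zeta t).1 / 2 - p t in
         exists alpha : cplx R,
           [/\ forall t, D t -> alpha = - PII_defect f p t,
               sol_PII f alpha D u &
               forall t, D t -> to_PII_XIII f p (zeta t, t) = (u t, derive1 u t)]),
      (forall (f : cplx R -> cplx R) (alpha : cplx R)
              (u p : cplx R -> cplx R),
         sol_PII f alpha D u ->
         (forall t, D t -> twice_derivable p t) ->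
         (forall t, D t -> alpha = - PII_defect f p t) ->
         sol_XIII f p (D `&` [set t | u t + p t != 0])
           (fun t => from_PII_XIII p (u t, derive1 u t, t))) &
      (forall f p : cplx R -> cplx R, (forall t, D t -> cond_XIII f p t) ->
       forall t, D t ->
         (forall y z : cplx R, y != 0 ->
            from_PII_XIII p (to_PII_XIII f p (y, z, t), t) = (y, z)) /\
         (forall u v : cplx R, u + p t != 0 ->
            to_PII_XIII f p (from_PII_XIII p (u, v, t), t) = (u, v)))]
  /\
  (* System XII. *)
  ((forall (f : cplx R -> cplx R) (a0 b0 : cplx R)
           (zeta : cplx R -> cplx R * cplx R),
      sol_XII f a0 b0 D zeta ->
      let u := fun t => (zeta t).2 in
      exists alpha beta : cplx R,
        [/\ forall t, D t -> alpha = a0 / 2 + b0 - derive1 f t,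
            beta = - (a0 ^+ 2 / 2),
            sol_PIV f alpha beta (D `&` [set t | u t != 0]) u &
            forall t, D t -> to_PIV_XII f a0 b0 (zeta t, t) = (u t, derive1 u t)])
   /\
   (forall (f : cplx R -> cplx R) (alpha beta : cplx R)
           (u : cplx R -> cplx R) (a0 b0 : cplx R),
      sol_PIV f alpha beta D u ->
      (forall t, D t -> alpha = a0 / 2 + b0 - derive1 f t) ->
      beta = - (a0 ^+ 2 / 2) ->
      sol_XII f a0 b0 D (fun t => from_PIV_XII f a0 (u t, derive1 u t, t)))).
Proof.
split; [split|split; [split|split]].
- by move=> f sf; rewrite sys_V_PI;
    exact/strongly_equivalentW/strongly_equivalent_refl.
- move=> q mq cq.
  have [f [sf qf]] : exists f, (forall t, second_derivative_zero f t) /\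
      generically (fun t => PI_defect q t = f t).
    by apply: generically_affine; apply: sub_generically cq => t [].
  exists f; split; [exact: sf|exact: qf| |].
    exact/strongly_equivalentW/IXB2_equivalent.
  exact/strongly_equivalentW/IXB5_equivalent.
- move=> r p mr mp cond.
  have [f [sf qf]] : exists f, (forall t, second_derivative_zero f t) /\
      generically (fun t => PI_defect (q_XIV r p) t = f t).
    by apply: generically_affine; apply: sub_generically cond => t [_ _ []].
  exists f; split; [exact: sf|exact: qf|].
  exact/strongly_equivalentW/XIV_equivalent.
- move=> f S S' sf cS cS'; apply: strongly_equivalentW.
  apply: strongly_equivalent_trans (PI_class_equivalent cS) _.
  exact: strongly_equivalentS (PI_class_equivalent cS').
- move=> f a0 sf; exists (a0 - derive1 f 0 / 2).
  have alphaE t : a0 - derive1 f 0 / 2 = a0 - derive1 f t / 2.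
    by rewrite (derive1_constant sf t).
  split; first exact: alphaE.
  by apply/strongly_equivalentW/IXB3_equivalent => // t; exact: (sf t).1.
- move=> f p sf mp cond.
  have [c cP] : exists c, generically (fun t => PII_defect f p t = c).
    by apply: generically_zero_derive; apply: sub_generically cond => t [].
  have alphaE : generically (fun t => - c = - PII_defect f p t).
    by apply: sub_generically cP => t ->.
  exists (- c); split; first exact: alphaE.
  by apply/strongly_equivalentW/XIII_equivalent => // t; exact: (sf t).1.
- move=> f a0 b0 sf; exists (a0 / 2 + b0 - derive1 f 0), (- (a0 ^+ 2 / 2)).
  have alphaE t : a0 / 2 + b0 - derive1 f 0 = a0 / 2 + b0 - derive1 f t.
    by rewrite (derive1_constant sf t).
  split; [exact: alphaE|by []|].
  by apply/strongly_equivalentW/XII_equivalent => // t; exact: (sf t).1.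
- exact: sys_V_PI.
move=> D Dd; have Do := Dd.1.
split; [split|split; [split|split; [split|split; [split|split; [split|split]]]]].
- by move=> q zeta; exact: sol_IXB2_to_PI.
- by move=> f q u; exact: sol_PI_to_IXB2.
- move=> q _ t _; split=> [y z|u v]; [exact: IXB2_fromK|exact: IXB2_toK].
- by move=> q zeta; exact: sol_IXB5_to_PI.
- by move=> f q u; exact: sol_PI_to_IXB5.
- move=> q _ t _; split=> [y z|u v]; [exact: IXB5_fromK|exact: IXB5_toK].
- by move=> r p zeta; exact: sol_XIV_to_PI.
- by move=> f q r p u; exact: sol_PI_to_XIV.
- move=> q r p cond qE t Dt.
  have r'E : derive1 r t = p t * r t.
    by have [dr _ _] := cond t Dt; exact: is_derive_derive1E dr.
  by split=> [y z|u v]; [exact: XIV_fromK r'E|exact: XIV_toK r'E].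
- by move=> f a0 zeta; exact: sol_IXB3_to_PII.
- by move=> f alpha u; exact: sol_PII_to_IXB3.
- move=> f a0 _ t _; split=> [y z|u v]; [exact: IXB3_fromK|exact: IXB3_toK].
- by move=> f p zeta; exact: sol_XIII_to_PII.
- by move=> f alpha u p; exact: sol_PII_to_XIII.
- move=> f p _ t _; split=> [y z|u v]; [exact: XIII_fromK|exact: XIII_toK].
- by move=> f a0 b0 zeta; exact: sol_XII_to_PIV.
- by move=> f alpha beta u a0 b0; exact: sol_PIV_to_XII.
Qed.
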